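(* Assume $f_1,\dots,f_m$ are general convex functions ($\mu=0$, $M>0$). Let $\mathbf{x}^*$ be an optimal solution of (P), and let $\mathbf{y}^*$ be such that $(\mathbf{x}^*,\mathbf{y}^* )$ is a saddle point of (SP). Assume the stochastic oracle is unbiased with variance bounded by $\sigma^2$ (conditions (A1) and (A2) of the context). Let $N\ge1$, $\tilde D>0$, and run the SDCS method with $\lambda_t=t+1$, $\beta_t=t/2$ for all $t\ge1$, and $$\alpha_k=\theta_k=1,\quad\eta_k=2\|\mathbf{L}\|,\quad\tau_k=\|\mathbf{L}\|,\quad T_k=\left\lceil\frac{m(M^2+\sigma^2)N}{\|\mathbf{L}\|^2\tilde D}\right\rceil,\qquad k=1,\dots,N.$$ Then $\hat{\mathbf{x}}^N_{\mathrm{avg}}:=\frac1N\sum_{k=1}^N\hat{\mathbf{x}}^k$ satisfies $$\mathbb{E}[F(\hat{\mathbf{x}}^N_{\mathrm{avg}})-F(\mathbf{x}^* )]\le\frac{\|\mathbf{L}\|}{N}\Big[3\mathbf{V}(\mathbf{x}^0,\mathbf{x}^* )+\tfrac12\|\mathbf{y}^0\|^2+4\tilde D\Big]$$ and $$\mathbb{E}[\|\mathbf{L}\hat{\mathbf{x}}^N_{\mathrm{avg}}\|]\le\frac{\|\mathbf{L}\|}{N}\Big[3\sqrt{6\mathbf{V}(\mathbf{x}^0,\mathbf{x}^* )+8\tilde D}+4\|\mathbf{y}^*-\mathbf{y}^0\|\Big].$$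
   Context: Setting. Let $m\ge 2$, $d\ge 1$, and let $\mathcal{G}=([m],\mathcal{E})$ be a connected undirected graph. Put $N_i=\{j:(i,j)\in\mathcal{E}\}\cup\{i\}$. The Laplacian $L\in\mathbb{R}^{m\times m}$ has $L_{ii}=|N_i|-1$, $L_{ij}=-1$ if $i\ne j$ and $(i,j)\in\mathcal{E}$, and $L_{ij}=0$ otherwise; $\mathbf{L}=L\otimes I_d$. For each $i\in[m]$, $X_i\subseteq\mathbb{R}^d$ is closed convex and $\bigcap_i X_i\neq\emptyset$; $\|\cdot\|_{X_i}$ is a norm on $\mathbb{R}^d$, with dual norm $\|\cdot\|_*$; $f_i:X_i\to\mathbb{R}$ is convex, with subgradients $f_i'(y)\in\partial f_i(y)$ satisfying $\frac{\mu}{2}\|x-y\|_{X_i}^2\le f_i(x)-f_i(y)-\langle f_i'(y),x-y\rangle\le M\|x-y\|_{X_i}$ for all $x,y\in X_i$. Prox-functions. $\omega_i:X_i\to\mathbb{R}$ is continuously differentiable with $\langle\nabla\omega_i(x)-\nabla\omega_i(u),x-u\rangle\ge\|x-u\|_{X_i}^2$, and $V_i(x,u)=\omega_i(u)-\omega_i(x)-\langle\nabla\omega_i(x),u-x\rangle$. Write $X^m=X_1\times\dots\times X_m$, $\mathbf{x}=(x_1,\dots,x_m)$, $\|\mathbf{x}\|^2=\sum_i\|x_i\|_{X_i}^2$ for primal vectors, $\mathbf{V}(\mathbf{x},\mathbf{u})=\sum_iV_i(x_i,u_i)$. Dual vectors $\mathbf{y}\in\mathbb{R}^{md}$ and vectors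 $\mathbf{L}\mathbf{x}$ are measured in the Euclidean norm, and $\|\mathbf{L}\|$ is the operator norm from the primal norm to the Euclidean norm. Problem. (P): minimize $F(\mathbf{x})=\sum_{i=1}^mf_i(x_i)$ subject to $\mathbf{L}\mathbf{x}=\mathbf{0}$, $\mathbf{x}\in X^m$. (SP): $\min_{\mathbf{x}\in X^m}\big[F(\mathbf{x})+\max_{\mathbf{y}\in\mathbb{R}^{md}}\langle\mathbf{L}\mathbf{x},\mathbf{y}\rangle\big]$. It is assumed that there are an optimal solution $\mathbf{x}^*$ of (P) and $\mathbf{y}^*\in\mathbb{R}^{md}$ such that $(\mathbf{x}^*,\mathbf{y}^* )$ is a saddle point of (SP). Stochastic oracle. At a point $u\in X_i$ the oracle for $f_i$ returns $G_i(u,\xi_i)$, where the random vector $\xi_i$ drawn at that call is independent of the search point at which the oracle is called. (A1) $\mathbb{E}[G_i(u,\xi_i)]=f_i'(u)\in\partial f_i(u)$. (A2) $\mathbb{E}[\|G_i(u,\xi_i)-f_i'(u)\|_*^2]\le\sigma^2$. SDCS method. Given (deterministic) $\mathbf{x}^0=\mathbf{x}^{-1}=\hat{\mathbf{x}}^0\in X^m$, $\mathbf{y}^0\in\mathbb{R}^{md}$, parameters $\alpha_k,\tau_k,\eta_k$, positive integers $T_k$, and inner parameters $\lambda_t,\beta_t$ (the $\theta_k$ are averaging weights), for $k=1,\dots,N$ set $\tilde{\mathbf{x}}^k=\alpha_k(\hat{\mathbf{x}}^{k-1}-\mathbf{x}^{k-2})+\mathbf{x}^{k-1}$; $\mathbf{y}^k=\mathbf{y}^{k-1}+\frac1{\tau_k}\mathbf{L}\tilde{\mathbf{x}}^k$;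 $\mathbf{w}^k=(w_1^k,\dots,w_m^k)=\mathbf{L}\mathbf{y}^k$; and for each $i\in[m]$: $u_i^{0,k}=x_i^{k-1}$; for $t=1,\dots,T_k$, $h_i^{t-1,k}=G_i(u_i^{t-1,k},\xi_i^{t-1,k})$ and $u_i^{t,k}=\arg\min_{u\in X_i}\big[\langle w_i^k+h_i^{t-1,k},u\rangle+\eta_kV_i(x_i^{k-1},u)+\eta_k\beta_tV_i(u_i^{t-1,k},u)\big]$; then $x_i^k=u_i^{T_k,k}$ and $\hat x_i^k=\big(\sum_{t=1}^{T_k}\lambda_t\big)^{-1}\sum_{t=1}^{T_k}\lambda_tu_i^{t,k}$. *)

(* Defs.v *)
From HB Require Import structures.
From mathcomp Require Import all_boot all_order all_algebra.
From mathcomp Require Import all_classical all_reals all_analysis.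

Set Implicit Arguments.
Unset Strict Implicit.
Unset Printing Implicit Defensive.

Import Order.TTheory GRing.Theory Num.Theory.
Import numFieldNormedType.Exports.

Local Open Scope classical_set_scope.
Local Open Scope ring_scope.

(* A vector of R^d is a row 'rV_d.  A stacked vector (x_1, ..., x_m) of R^{md}
   is the m x d matrix x whose i-th row is x_i; with this layout, the operator
   L (x) I_d is x |-> L *m x, since row i of L *m x is \sum_j L i j *: x_j. *)

Section Graph.
Variables (R : realType) (m : nat) (e : rel 'I_m).

Definition nbhd (i : 'I_m) : {set 'I_m} := [set j | e i j] :|: [set i].

Definition laplacian : 'M[R]_m :=
  \matrix_(i, j) if i == j then #|nbhd i|%:R - 1
                 else if e i j then -1 else 0.

Definition connected_undirected : Prop :=
  symmetric e /\ forall i j, connect e i j.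

End Graph.

Section Norms.
Variable R : realType.

Definition dot p q (x y : 'M[R]_(p, q)) : R := \sum_i \sum_j x i j * y i j.

Definition l2norm p q (x : 'M[R]_(p, q)) : R := Num.sqrt (dot x x).

Record is_norm d (nu : 'rV[R]_d -> R) : Prop := IsNorm {
  norm_triangle : forall x y, nu (x + y) <= nu x + nu y;
  norm_homogeneous : forall (a : R) x, nu (a *: x) = `|a| * nu x;
  norm_definite : forall x, nu x = 0 -> x = 0 }.

Definition dual_norm d (nu : 'rV[R]_d -> R) (y : 'rV[R]_d) : R :=
  sup [set dot y x | x in [set x | nu x <= 1]].

Definition primal_norm m d (nu : 'I_m -> 'rV[R]_d -> R) (x : 'M[R]_(m, d)) : R :=
  Num.sqrt (\sum_i nu i (row i x) ^+ 2).

Definition opnorm m d (nu : 'I_m -> 'rV[R]_d -> R) (A : 'M[R]_m) : R :=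
  sup [set l2norm (A *m x) | x in [set x : 'M[R]_(m, d) | primal_norm nu x <= 1]].

End Norms.

Section ConvexData.
Variables (R : realType) (d : nat).
Implicit Types (X : set 'rV[R]_d) (nu f om : 'rV[R]_d -> R)
  (gom : 'rV[R]_d -> 'rV[R]_d).

(* Functions on X are represented by total functions whose values outside X
   are never used. *)

Definition subdifferential X f (y : 'rV[R]_d) : set 'rV[R]_d :=
  [set g | forall x, X x -> f y + dot g (x - y) <= f x].

Record objective X nu (mu M : R) f
    (f' : 'rV[R]_d -> 'rV[R]_d) : Prop := Objective {
  objective_convex : convex_function X f;
  objective_subgradient : forall y, X y -> subdifferential X f y (f' y);
  objective_bounds : forall x y, X x -> X y ->
    mu / 2 * nu (x - y) ^+ 2 <= f x - f y - dot (f' y) (x - y) <= M * nu (x - y) }.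

(* X need not have interior points: gom is a continuous choice on X of a
   gradient of om relative to X.  It is determined only up to directions
   orthogonal to X - X, on which [bregman om gom] does not depend. *)
Definition cont_differentiable_on X om gom : Prop :=
  {within X, continuous gom} /\
  forall x, X x -> forall eps : R, 0 < eps ->
    \forall u \near within X (nbhs x),
      `|om u - om x - dot (gom x) (u - x)| <= eps * `|u - x|.

Record prox_function X nu om gom : Prop := ProxFunction {
  prox_C1 : cont_differentiable_on X om gom;
  prox_strongly_monotone : forall x u, X x -> X u ->
    nu (x - u) ^+ 2 <= dot (gom x - gom u) (x - u) }.

Definition bregman om gom (x u : 'rV[R]_d) : R :=
  om u - om x - dot (gom x) (u - x).

Definition is_argmin X f (u : 'rV[R]_d) : Prop :=
  X u /\ forall v, X v -> f u <= f v.

End ConvexData.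

Section Problem.
Variables (R : realType) (m d : nat).
Implicit Types (X : 'I_m -> set 'rV[R]_d) (f : 'I_m -> 'rV[R]_d -> R)
  (L : 'M[R]_m) (x y : 'M[R]_(m, d)).

Definition prod_set X : set 'M[R]_(m, d) := [set x | forall i, X i (row i x)].

Definition total_obj f x : R := \sum_i f i (row i x).

Definition optimal_solution L X f x : Prop :=
  [/\ prod_set X x, L *m x = 0 &
      forall z, prod_set X z -> L *m z = 0 -> total_obj f x <= total_obj f z].

Definition lagrangian L f x y : R := total_obj f x + dot (L *m x) y.

Definition saddle_point L X f x y : Prop :=
  [/\ prod_set X x,
      forall z, lagrangian L f x z <= lagrangian L f x y &
      forall z, prod_set X z -> lagrangian L f x y <= lagrangian L f z y].

Definition sum_bregman (om : 'I_m -> 'rV[R]_d -> R)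
    (gom : 'I_m -> 'rV[R]_d -> 'rV[R]_d) x u : R :=
  \sum_i bregman (om i) (gom i) (row i x) (row i u).

End Problem.

(* One realization of the method: [xi i k t] is the realized draw xi_i^{t,k},
   [h i k t] and [u i k t] stand for h_i^{t,k} and u_i^{t,k}.  For k = 1 the
   truncated k.-2 is 0, which encodes the convention x^{-1} = x^0. *)
Record sdcs_run (R : realType) (m d : nat) (L : 'M[R]_m)
    (X : 'I_m -> set 'rV[R]_d)
    (om : 'I_m -> 'rV[R]_d -> R) (gom : 'I_m -> 'rV[R]_d -> 'rV[R]_d)
    (Xi : 'I_m -> Type) (G : forall i, 'rV[R]_d -> Xi i -> 'rV[R]_d)
    (N : nat) (alpha tau eta : nat -> R) (T : nat -> nat) (lambda beta : nat -> R)
    (x0 y0 : 'M[R]_(m, d)) (xi : forall i, nat -> nat -> Xi i)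
    (x xhat xtil y w : nat -> 'M[R]_(m, d))
    (h u : 'I_m -> nat -> nat -> 'rV[R]_d) : Prop := SdcsRun {
  sdcs_x0 : x 0%N = x0;
  sdcs_xhat0 : xhat 0%N = x0;
  sdcs_y0 : y 0%N = y0;
  sdcs_xtil : forall k, (1 <= k <= N)%N ->
    xtil k = alpha k *: (xhat k.-1 - x k.-2) + x k.-1;
  sdcs_y : forall k, (1 <= k <= N)%N ->
    y k = y k.-1 + (tau k)^-1 *: (L *m xtil k);
  sdcs_w : forall k, (1 <= k <= N)%N -> w k = L *m y k;
  sdcs_u0 : forall i k, (1 <= k <= N)%N -> u i k 0%N = row i (x k.-1);
  sdcs_h : forall i k t, (1 <= k <= N)%N -> (1 <= t <= T k)%N ->
    h i k t.-1 = G i (u i k t.-1) (xi i k t.-1);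
  sdcs_u : forall i k t, (1 <= k <= N)%N -> (1 <= t <= T k)%N ->
    is_argmin (X i)
      (fun v => dot (row i (w k) + h i k t.-1) v
                + eta k * bregman (om i) (gom i) (row i (x k.-1)) v
                + eta k * beta t * bregman (om i) (gom i) (u i k t.-1) v)
      (u i k t);
  sdcs_x : forall i k, (1 <= k <= N)%N -> row i (x k) = u i k (T k);
  sdcs_xhat : forall i k, (1 <= k <= N)%N ->
    row i (xhat k) = (\sum_(1 <= t < (T k).+1) lambda t)^-1 *:
                     \sum_(1 <= t < (T k).+1) lambda t *: u i k t }.

Definition borel_rV (R : realType) (d : nat) :=
  g_sigma_algebraType (@open 'rV[R]_d).

Section Probability.
Local Open Scope ereal_scope.

Definition independent_rv (d d1 d2 : measure_display) (R : realType)
    (Omega : measurableType d) (P : probability Omega R)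
    (T1 : measurableType d1) (T2 : measurableType d2)
    (Y : Omega -> T1) (Z : Omega -> T2) : Prop :=
  forall A B, measurable A -> measurable B ->
    P (Y @^-1` A `&` Z @^-1` B) = P (Y @^-1` A) * P (Z @^-1` B).

Variables (d : measure_display) (R : realType) (Omega : measurableType d).
Variable P : probability Omega R.

(* The library's expectation is total; integrability makes E[Y] meaningful. *)
Definition mean_at_most (Y : Omega -> R) (c : R) : Prop :=
  P.-integrable setT (EFin \o Y) /\ 'E_P[Y] <= c%:E.

Definition has_mean n (Y : Omega -> 'rV[R]_n) (v : 'rV[R]_n) : Prop :=
  forall j, P.-integrable setT (fun w => (Y w ord0 j)%:E) /\
            'E_P[fun w => Y w ord0 j] = (v ord0 j)%:E.

End Probability.

(* Main.v *)
(* Fix a realization and put p_k = xhat^k - x^{k-1}.  The three-point inequality for the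
   prox step, weighted by lambda_t and summed over the inner loop, bounds
   F(xhat^k) - F(xstar) + <L y^k, xhat^k - xstar> + |L| |p_k|^2 by a telescoping Bregman term plus
   noise.  Since y^k is a gradient step on the multiplier along xtil^k, and
   xhat^k - xtil^k = p_k - p_{k-1}, adding the two gives for every z
     sum_k [F(xhat^k) - F(xstar) + <L xhat^k, z>]
       <= 3 |L| V(x^0, xstar) + |L|/2 |y^0 - z|^2 + noise
          - |L| (b^2/2 - a b + a^2),   a = |p_N|,  b = |y^N - z|.
   The choice z = 0 bounds the objective.  For z = ystar the left side is nonnegative, so
   (a + b)^2 <= 10 (b^2/2 - a b + a^2) is controlled, and
   L (sum_k xhat^k) = |L| (y^N - y^0) + L p_N bounds the infeasibility.  The square root is
   linearized as a + b <= (a + b)^2/(2c) + c/2 with a constant c, so that only the mean of the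
   noise matters.  The noise is linear in <G - f', u - xstar>, of mean zero by Fubini because
   each draw is independent of its search point and xstar is deterministic, and in |G - f'|^2. *)
Require Import Defs.
From HB Require Import structures.
From mathcomp Require Import all_boot all_order all_algebra.
From mathcomp Require Import all_classical all_reals all_analysis.
From mathcomp Require Import measurable_realfun ring lra zify.

Set Implicit Arguments.
Unset Strict Implicit.
Unset Printing Implicit Defensive.

Import Order.TTheory GRing.Theory Num.Theory.
Import numFieldNormedType.Exports.

Local Open Scope classical_set_scope.
Local Open Scope ring_scope.

(** * The inner product and norms on R^d *)

(** The surplus [|L| |p_k|^2] comes from [eta = 2 |L|]: the anchor term [eta V(x^{k-1}, u)] is at
    least [|L|] times a squared distance, and this convex function of [u] survives averaging. Half
    of it pays for the coupling of [p_{k-1}] with the multiplier step. The factor 3 in front of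
    [V(x^0, xstar)] bounds [2 (1 + 1/S)], where [S >= 2] is the sum of the inner weights, and the
    length of the inner loop makes the mean noise of one outer iteration at most [4 |L| D / N].

    Much of the work goes into the existence of the expectations. The iterates are given only as
    minimizers. They are measurable because a minimizer is a Lipschitz function of its linear data,
    and integrability comes from an induction along the run that carries domination of
    [V(u, xstar)], the quantity that a prox step controls. The objective gap has no sign; its
    negative part is integrable because the saddle inequality bounds the gap below by
    [- <L x, ystar>]. So the objective estimate relies on the feasibility estimate. *)

Section Dot.
Variables (R : realType) (p q : nat).
Implicit Types x y z : 'M[R]_(p, q).

Lemma dotC x y : dot x y = dot y x.
Proof. by apply: eq_bigr => i _; apply: eq_bigr => j _; rewrite mulrC. Qed.

Lemma dotDl x y z : dot (x + y) z = dot x z + dot y z.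
Proof.
rewrite -big_split; apply: eq_bigr => i _ /=; rewrite -big_split.
by apply: eq_bigr => j _; rewrite mxE mulrDl.
Qed.

Lemma dotZl a x y : dot (a *: x) y = a * dot x y.
Proof.
rewrite mulr_sumr; apply: eq_bigr => i _; rewrite mulr_sumr.
by apply: eq_bigr => j _; rewrite mxE mulrA.
Qed.

Lemma dotNl x y : dot (- x) y = - dot x y.
Proof. by rewrite -scaleN1r dotZl mulN1r. Qed.

Lemma dotBl x y z : dot (x - y) z = dot x z - dot y z.
Proof. by rewrite dotDl dotNl. Qed.

Lemma dotDr x y z : dot z (x + y) = dot z x + dot z y.
Proof. by rewrite dotC dotDl !(dotC z). Qed.

Lemma dotZr a x y : dot y (a *: x) = a * dot y x.
Proof. by rewrite dotC dotZl dotC. Qed.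

Lemma dotNr x y : dot y (- x) = - dot y x.
Proof. by rewrite dotC dotNl dotC. Qed.

Lemma dotBr x y z : dot z (x - y) = dot z x - dot z y.
Proof. by rewrite dotDr dotNr. Qed.

Lemma dot0l y : dot (0 : 'M[R]_(p, q)) y = 0.
Proof. by rewrite -(scale0r y) dotZl mul0r. Qed.

Lemma dot0r y : dot y (0 : 'M[R]_(p, q)) = 0.
Proof. by rewrite dotC dot0l. Qed.

Lemma dot_ge0 x : 0 <= dot x x.
Proof. by apply: sumr_ge0 => i _; apply: sumr_ge0 => j _; rewrite -expr2 sqr_ge0. Qed.

Lemma dot_entry x i j : x i j ^+ 2 <= dot x x.
Proof.
rewrite /dot (bigD1 i)//= (bigD1 j)//= -expr2 -addrA lerDl addr_ge0//.
  by apply: sumr_ge0 => *; rewrite -expr2 sqr_ge0.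
by apply: sumr_ge0 => k _; apply: sumr_ge0 => *; rewrite -expr2 sqr_ge0.
Qed.

Lemma dot_row x y : dot x y = \sum_i dot (row i x) (row i y).
Proof.
apply: eq_bigr => i _; rewrite /dot big_ord1.
by apply: eq_bigr => j _; rewrite !mxE.
Qed.

Lemma l2norm_ge0 x : 0 <= l2norm x.
Proof. exact: sqrtr_ge0. Qed.

Lemma l2norm_sq x : l2norm x ^+ 2 = dot x x.
Proof. by rewrite sqr_sqrtr ?dot_ge0. Qed.

Lemma l2norm0_eq0 x : l2norm x = 0 -> x = 0.
Proof.
move=> x0; apply/matrixP => i j; rewrite mxE; apply/eqP.
rewrite -sqrf_eq0 eq_le sqr_ge0 andbT (le_trans (dot_entry x i j))//.
by rewrite -l2norm_sq x0 expr0n.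
Qed.

(** Cauchy-Schwarz, from the nonnegative square of [l2norm y *: x - l2norm x *: y], which is
    [2 a b (a b - dot x y)] for [a = l2norm x] and [b = l2norm y]. *)
Lemma dot_le_l2norm x y : dot x y <= l2norm x * l2norm y.
Proof.
have [/l2norm0_eq0->|x0] := eqVneq (l2norm x) 0.
  by rewrite dot0l mulr_ge0// l2norm_ge0.
have [/l2norm0_eq0->|y0] := eqVneq (l2norm y) 0.
  by rewrite dot0r mulr_ge0// l2norm_ge0.
have := dot_ge0 (l2norm y *: x - l2norm x *: y).
rewrite !(dotBl, dotBr, dotZl, dotZr) -!l2norm_sq (dotC y x).
have a0 : 0 < l2norm x by rewrite lt0r x0 l2norm_ge0.
have b0 : 0 < l2norm y by rewrite lt0r y0 l2norm_ge0.
move: (l2norm x) (l2norm y) a0 b0 => a b a0 b0 h.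
have : 0 <= (2 * a * b) * (a * b - dot x y) by nra.
by rewrite pmulr_rge0 ?subr_ge0// !mulr_gt0.
Qed.

Lemma l2normN x : l2norm (- x) = l2norm x.
Proof. by rewrite /l2norm dotNl dotNr opprK. Qed.

Lemma l2normZ a x : l2norm (a *: x) = `|a| * l2norm x.
Proof. by rewrite /l2norm dotZl dotZr mulrA -expr2 sqrtrM ?sqr_ge0// sqrtr_sqr. Qed.

Lemma l2norm_triangle x y : l2norm (x + y) <= l2norm x + l2norm y.
Proof.
rewrite -(@ler_pXn2r _ 2)// ?nnegrE ?addr_ge0 ?l2norm_ge0//.
rewrite sqrrD !l2norm_sq !(dotDl, dotDr) (dotC y x).
have := dot_le_l2norm x y; lra.
Qed.

Lemma ler_mx_entry x i j : `|x i j| <= `|x|.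
Proof.
by rewrite [leRHS]/Num.norm/= mx_normrE; apply: (le_bigmax _ (fun ij => `|x ij.1 ij.2|) (i, j)).
Qed.

Lemma dot_le_norm x y : `|dot x y| <= (p * q)%:R * `|x| * `|y|.
Proof.
rewrite (le_trans (ler_norm_sum _ _ _))//.
have h i : `|\sum_j x i j * y i j| <= q%:R * (`|x| * `|y|).
  rewrite (le_trans (ler_norm_sum _ _ _))//.
  have -> : q%:R * (`|x| * `|y|) = \sum_(j < q) (`|x| * `|y|).
    by rewrite sumr_const card_ord mulr_natl.
  by apply: ler_sum => j _; rewrite normrM ler_pM ?ler_mx_entry.
rewrite (le_trans (ler_sum _ (fun i _ => h i)))//.
by rewrite sumr_const card_ord -[leLHS]mulr_natl natrM !mulrA.
Qed.

Lemma l2norm_le_norm x : l2norm x <= ((p * q)%:R + 1) * `|x|.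
Proof.
rewrite -(@ler_pXn2r _ 2)// ?nnegrE ?mulr_ge0 ?l2norm_ge0//.
rewrite l2norm_sq (le_trans (ler_norm _))// (le_trans (dot_le_norm _ _))//.
rewrite exprMn -mulrA -expr2 ler_wpM2r ?sqr_ge0//.
have : 0 <= (p * q)%:R :> R by []. nra.
Qed.

Lemma mx_norm_leP x (c : R) : 0 <= c -> (forall i j, `|x i j| <= c) -> `|x| <= c.
Proof.
by move=> c0 h; rewrite [leLHS]/Num.norm/= mx_normrE; apply/bigmax_leP; split => // -[i j].
Qed.

Lemma norm_row i x : `|row i x| <= `|x|.
Proof.
rewrite [leLHS]/Num.norm/= mx_normrE; apply/bigmax_leP; split => // -[i' j] _ /=.
by rewrite mxE ler_mx_entry.
Qed.

Lemma norm_rows x : `|x| ^+ 2 <= \sum_i `|row i x| ^+ 2.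
Proof.
have s0 : 0 <= \sum_i `|row i x| ^+ 2 by rewrite sumr_ge0// => i _; exact: sqr_ge0.
rewrite -(sqr_sqrtr s0) ler_pXn2r ?nnegrE ?sqrtr_ge0//.
apply: mx_norm_leP => [|i j]; first exact: sqrtr_ge0.
rewrite -(@ler_pXn2r _ 2)// ?nnegrE ?sqrtr_ge0// (sqr_sqrtr s0) (bigD1 i)//=.
rewrite -[leLHS]addr0 lerD //; last by apply: sumr_ge0 => k _; exact: sqr_ge0.
rewrite ler_pXn2r ?nnegrE//; have -> : x i j = row i x ord0 j by rewrite mxE.
rewrite [leRHS]/Num.norm/= mx_normrE.
exact: (le_bigmax _ (fun ij => `|row i x ij.1 ij.2|) (ord0, j)).
Qed.

End Dot.

Lemma norm_mulmx (R : realType) p q r (A : 'M[R]_(p, q)) (x : 'M[R]_(q, r)) :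
  `|A *m x| <= q%:R * `|A| * `|x|.
Proof.
apply: mx_norm_leP => [|i j]; first by rewrite !mulr_ge0.
rewrite mxE (le_trans (ler_norm_sum _ _ _))//.
have -> : q%:R * `|A| * `|x| = \sum_(k < q) (`|A| * `|x|).
  by rewrite sumr_const card_ord -[RHS]mulr_natl mulrA.
by apply: ler_sum => k _; rewrite normrM ler_pM ?ler_mx_entry.
Qed.

Lemma dot_mulmx (R : realType) m d (A : 'M[R]_m) (x y : 'M[R]_(m, d)) :
  dot (A *m x) y = dot x (A^T *m y).
Proof.
rewrite /dot exchange_big [RHS]exchange_big; apply: eq_bigr => j _ /=.
transitivity (\sum_i \sum_k A i k * x k j * y i j).
  by apply: eq_bigr => i _; rewrite mxE mulr_suml.
rewrite exchange_big; apply: eq_bigr => k _ /=.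
rewrite mxE mulr_sumr; apply: eq_bigr => i _; rewrite mxE; ring.
Qed.

(** * Equivalence of an abstract norm with the maximum norm; the dual norm *)

Section NormEquivalence.
Variables (R : realType) (d : nat) (nu : 'rV[R]_d -> R).
Hypothesis nu_norm : is_norm nu.

Lemma nu0 : nu 0 = 0.
Proof. by rewrite -(scale0r 0) (norm_homogeneous nu_norm) normr0 mul0r. Qed.

Lemma nuN x : nu (- x) = nu x.
Proof. by rewrite -scaleN1r (norm_homogeneous nu_norm) normrN1 mul1r. Qed.

Lemma nuB x y : nu (x - y) = nu (y - x).
Proof. by rewrite -nuN opprB. Qed.

Lemma nu_ge0 x : 0 <= nu x.
Proof.
have := norm_triangle nu_norm x (- x).
by rewrite subrr nu0 nuN; lra.
Qed.

Lemma nu_sum I (r : seq I) (F : I -> 'rV[R]_d) :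
  nu (\sum_(i <- r) F i) <= \sum_(i <- r) nu (F i).
Proof.
elim/big_rec2 : _ => [|i a b _ ab]; first by rewrite nu0.
by rewrite (le_trans (norm_triangle nu_norm _ _))// lerD2l.
Qed.

Lemma nu_le_norm : exists2 C, 0 < C & forall x, nu x <= C * `|x|.
Proof.
exists (1 + \sum_j nu (delta_mx ord0 j)) => [|x].
  by rewrite ltr_pwDl// sumr_ge0// => j _; exact: nu_ge0.
rewrite {1}(row_sum_delta x) mulrDl mul1r -[leLHS]add0r lerD//.
rewrite (le_trans (nu_sum _ _))// mulr_suml; apply: ler_sum => j _.
by rewrite (norm_homogeneous nu_norm) mulrC ler_wpM2l ?nu_ge0 ?ler_mx_entry.
Qed.

Lemma nu_lip : exists2 C, 0 < C & forall x y, `|nu x - nu y| <= C * `|x - y|.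
Proof.
have [C C0 h] := nu_le_norm; exists C => // x y.
have h1 := norm_triangle nu_norm (x - y) y.
have h2 := norm_triangle nu_norm (y - x) x.
have := h (x - y); have := h (y - x); rewrite !subrK in h1 h2.
rewrite (distrC y x) ler_norml; lra.
Qed.

Lemma nu_continuous : continuous nu.
Proof.
have [C C0 h] := nu_lip => x U /nbhs_ballP[e /= e0 eU]; apply/nbhs_ballP.
exists (e / C) => [|y] /=; first exact: divr_gt0.
rewrite -ball_normE /= ltr_pdivlMr// mulrC => xy; apply: eU.
by rewrite -ball_normE /=; exact: le_lt_trans (h _ _) xy.
Qed.

(** By compactness: [nu] is continuous and attains a minimum on the unit sphere of the maximum norm,
    which is positive because [nu] is definite. This makes the suprema in [dual_norm] and [opnorm]
    finite. *)
Lemma norm_le_nu : exists2 C, 0 < C & forall x, `|x| <= C * nu x.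
Proof.
pose S := [set x : 'rV[R]_d | `|x| = 1].
have [[x0 Sx0]|S0] := pselect (S !=set0); last first.
  (* An empty sphere forces every vector to be zero ([d = 0]), and any constant will do. *)
  exists 1 => // x; have [->|x0] := eqVneq x 0.
    by rewrite normr0 nu0 mulr0.
  exfalso; apply: S0; exists (`|x|^-1 *: x); rewrite /S /=.
  by rewrite normrZ normfV normr_id mulVf// normr_eq0.
have cS : compact S.
  apply: bounded_closed_compact.
    by exists 1; split => // M M1 x /= ->; exact: ltW.
  have -> : S = (fun x : 'rV[R]_d => `|x|) @^-1` [set 1] by [].
  by apply: preimage_closed; [move=> x _; exact: norm_continuous|exact: closed_eq].
have [|c cS' cmin] := EVT_min_rV (ex_intro _ _ Sx0) cS (f := nu).
  by apply: continuous_subspaceT => x; exact: nu_continuous.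
have c0 : 0 < nu c.
  rewrite lt0r nu_ge0 andbT; apply/eqP => /(norm_definite nu_norm) c0.
  by move: cS'; rewrite inE /S /= c0 normr0 => /esym/eqP; rewrite oner_eq0.
exists (nu c)^-1 => [|x]; first by rewrite invr_gt0.
have [->|x0'] := eqVneq x 0; first by rewrite normr0 nu0 mulr0.
have x1 : 0 < `|x| by rewrite normr_gt0.
have := cmin (`|x|^-1 *: x); rewrite inE /S /= normrZ normfV normr_id.
rewrite mulVf ?normr_eq0// => /(_ erefl).
rewrite (norm_homogeneous nu_norm) normfV normr_id.
by rewrite !ler_pdivlMl// mulrC.
Qed.

Let dset (y : 'rV[R]_d) := [set dot y x | x in [set x | nu x <= 1]].

(** [sup] is meaningful only for a nonempty set bounded above, so every use of [dual_norm] rests on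
    this. *)
Lemma dual_norm_has_sup y : has_sup (dset y).
Proof.
split; first by exists (dot y 0), 0 => //=; rewrite nu0.
have [C C0 h] := norm_le_nu.
exists ((1 * d)%:R * `|y| * C) => _ [x /= x1 <-].
rewrite (le_trans (ler_norm _))// (le_trans (dot_le_norm _ _))//.
by rewrite ler_wpM2l ?mulr_ge0// (le_trans (h x))// ler_piMr// ltW.
Qed.

Lemma dot_le_dual y x : dot y x <= dual_norm nu y * nu x.
Proof.
have [/(norm_definite nu_norm)->|x0] := eqVneq (nu x) 0.
  by rewrite dot0r nu0 mulr0.
have x1 : 0 < nu x by rewrite lt0r x0 nu_ge0.
rewrite -ler_pdivrMr// mulrC -dotZr.
apply: sup_upper_bound; first exact: dual_norm_has_sup.
exists ((nu x)^-1 *: x) => //=.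
by rewrite (norm_homogeneous nu_norm) ger0_norm ?invr_ge0 ?nu_ge0// mulVf.
Qed.

Lemma dual_norm_ge0 y : 0 <= dual_norm nu y.
Proof.
rewrite -(dot0r y); apply: sup_upper_bound; first exact: dual_norm_has_sup.
by exists 0 => //=; rewrite nu0.
Qed.

Lemma dual_norm_le y c : (forall x, nu x <= 1 -> dot y x <= c) -> dual_norm nu y <= c.
Proof.
move=> h; apply: ge_sup; first by have [] := dual_norm_has_sup y.
by move=> _ [x /= x1 <-]; exact: h.
Qed.

Lemma dual_norm_triangle y z : dual_norm nu (y + z) <= dual_norm nu y + dual_norm nu z.
Proof.
apply: dual_norm_le => x x1; rewrite dotDl.
have := dot_le_dual y x; have := dot_le_dual z x.
have := dual_norm_ge0 y; have := dual_norm_ge0 z; have := nu_ge0 x; nra.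
Qed.

Lemma dual_norm_le_norm : exists2 C, 0 < C & forall y, dual_norm nu y <= C * `|y|.
Proof.
have [C C0 h] := norm_le_nu.
exists ((1 * d)%:R * C + 1) => [|y]; first by rewrite ltr_wpDl// mulr_ge0// ltW.
apply: dual_norm_le => x x1; rewrite (le_trans (ler_norm _))//.
rewrite (le_trans (dot_le_norm _ _))// mulrDl mul1r.
rewrite (@le_trans _ _ ((1 * d)%:R * `|y| * C))//.
  by rewrite ler_wpM2l ?mulr_ge0// (le_trans (h x))// ler_piMr// ltW.
by rewrite mulrAC lerDl.
Qed.

Lemma dual_norm_lip : exists2 C, 0 < C &
  forall x y, `|dual_norm nu x - dual_norm nu y| <= C * `|x - y|.
Proof.
have [C C0 h] := dual_norm_le_norm; exists C => // x y.
have h1 := dual_norm_triangle (x - y) y.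
have h2 := dual_norm_triangle (y - x) x.
have := h (x - y); have := h (y - x); rewrite !subrK in h1 h2.
rewrite (distrC y x) ler_norml; lra.
Qed.

End NormEquivalence.

(** * The operator norm from the primal norm to the Euclidean norm *)

Section OperatorNorm.
Variables (R : realType) (m d : nat) (nu : 'I_m -> 'rV[R]_d -> R) (A : 'M[R]_m).
Hypothesis nu_norm : forall i, is_norm (nu i).
Implicit Types x : 'M[R]_(m, d).

Lemma primal_norm_ge0 x : 0 <= primal_norm nu x.
Proof. exact: sqrtr_ge0. Qed.

Lemma primal_norm_sq x : primal_norm nu x ^+ 2 = \sum_i nu i (row i x) ^+ 2.
Proof. by rewrite sqr_sqrtr// sumr_ge0// => i _; exact: sqr_ge0. Qed.

Lemma nu_le_primal i x : nu i (row i x) <= primal_norm nu x.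
Proof.
rewrite -(@ler_pXn2r _ 2)// ?nnegrE ?primal_norm_ge0 ?nu_ge0//.
by rewrite primal_norm_sq (bigD1 i)//= lerDl sumr_ge0// => j _; exact: sqr_ge0.
Qed.

Lemma primal_norm0_eq0 x : primal_norm nu x = 0 -> x = 0.
Proof.
move=> h; apply/row_matrixP => i; rewrite row0; apply: (norm_definite (nu_norm i)).
by apply/eqP; rewrite eq_le nu_ge0// andbT -h nu_le_primal.
Qed.

Lemma primal_normZ a x : primal_norm nu (a *: x) = `|a| * primal_norm nu x.
Proof.
rewrite /primal_norm -sqrtr_sqr -sqrtrM ?sqr_ge0//; congr Num.sqrt.
rewrite mulr_sumr; apply: eq_bigr => i _.
by rewrite linearZ/= (norm_homogeneous (nu_norm i)) exprMn real_normK ?num_real.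
Qed.

Lemma primal_norm0 : primal_norm nu 0 = 0.
Proof. by rewrite -(scale0r 0) primal_normZ normr0 mul0r. Qed.

Lemma norm_le_primal : exists2 C, 0 < C & forall x, `|x| <= C * primal_norm nu x.
Proof.
have /choice[c hc] : forall i, exists c, 0 < c /\ forall z, `|z| <= c * nu i z.
  by move=> i; have [c c0 h] := norm_le_nu (nu_norm i); exists c.
exists (1 + \sum_i c i) => [|x].
  by rewrite ltr_pwDl// sumr_ge0// => i _; apply/ltW/(hc i).1.
apply: mx_norm_leP => [|i j].
  by rewrite mulr_ge0 ?primal_norm_ge0// addr_ge0// sumr_ge0// => i _; apply/ltW/(hc i).1.
have -> : x i j = row i x ord0 j by rewrite mxE.
rewrite (le_trans (ler_mx_entry _ _ _))// (le_trans ((hc i).2 _))//.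
apply: ler_pM; [exact/ltW/(hc i).1|exact: nu_ge0| |exact: nu_le_primal].
rewrite (bigD1 i)//= addrCA lerDl addr_ge0// sumr_ge0// => k _; exact/ltW/(hc k).1.
Qed.

Let oset := [set l2norm (A *m x) | x in [set x : 'M[R]_(m, d) | primal_norm nu x <= 1]].

Lemma opnorm_has_sup : has_sup oset.
Proof.
split; first by exists (l2norm (A *m (0 : 'M[R]_(m, d)))), 0 => //=; rewrite primal_norm0.
have [C C0 h] := norm_le_primal.
exists (((m * d)%:R + 1) * (m%:R * `|A| * C)) => _ [x /= x1 <-].
rewrite (le_trans (l2norm_le_norm _))// ler_wpM2l ?addr_ge0//.
rewrite (le_trans (norm_mulmx _ _))// ler_wpM2l ?mulr_ge0// (le_trans (h x))//.
by rewrite ler_piMr// ltW.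
Qed.

Lemma opnorm_bound x : l2norm (A *m x) <= opnorm nu A * primal_norm nu x.
Proof.
have [/primal_norm0_eq0->|x0] := eqVneq (primal_norm nu x) 0.
  rewrite -(scale0r 0) primal_normZ normr0 mul0r mulr0.
  by rewrite linearZ/= l2normZ normr0 mul0r.
have x1 : 0 < primal_norm nu x by rewrite lt0r x0 primal_norm_ge0.
rewrite -ler_pdivrMr// mulrC.
apply: sup_upper_bound; first exact: opnorm_has_sup.
exists ((primal_norm nu x)^-1 *: x) => /=.
  by rewrite primal_normZ ger0_norm ?invr_ge0 ?primal_norm_ge0// mulVf.
by rewrite linearZ/= l2normZ ger0_norm// invr_ge0 primal_norm_ge0.
Qed.

Lemma opnorm_ge0 : 0 <= opnorm nu A.
Proof.
apply: (le_trans (l2norm_ge0 (A *m (0 : 'M[R]_(m, d))))).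
apply: sup_upper_bound; first exact: opnorm_has_sup.
by exists 0 => //=; rewrite primal_norm0.
Qed.

End OperatorNorm.

(** * Positivity of the operator norm of the Laplacian *)

Section Laplacian.
Variables (R : realType) (m : nat) (e : rel 'I_m).
Hypotheses (m_ge2 : (2 <= m)%N) (e_conn : connected_undirected e).

Lemma laplacian_sym : (laplacian R e)^T = laplacian R e.
Proof.
apply/matrixP => i j; rewrite !mxE (e_conn.1 j i) eq_sym.
by case: eqVneq => // ->.
Qed.

(** Otherwise [{i}] would be closed under adjacency, and connectivity would leave [i] as the only
    vertex, against [m >= 2]. *)
Lemma exists_neighbour (i : 'I_m) : exists2 j, e i j & j != i.
Proof.
apply: contrapT => no_nbr.
have [j ji] : exists j : 'I_m, j != i.
  have [i0|i0] := eqVneq (i : nat) 0%N.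
    by exists (Ordinal m_ge2); rewrite -val_eqE /= i0.
  by exists (Ordinal (ltnW m_ge2)); rewrite -val_eqE /= eq_sym.
have cl : fingraph.closed e (pred1 i).
  apply: (intro_closed (sym_connect_sym e_conn.1)) => x y exy /eqP xi.
  by rewrite xi in exy; apply: contrapT => /negP yi; apply: no_nbr; exists y.
have := closed_connect cl (e_conn.2 i j).
by rewrite !inE eqxx (negbTE ji).
Qed.

Lemma laplacian_diag_gt0 i : 0 < laplacian R e i i.
Proof.
rewrite mxE eqxx subr_gt0 ltr1n.
have [j eij ji] := exists_neighbour i.
have : [set i; j]%SET \subset nbhd e i.
  by apply/fintype.subsetP => k; rewrite !inE => /orP[->|/eqP->]; rewrite ?orbT// eij.
by move/subset_leq_card; rewrite cards2 eq_sym ji.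
Qed.

(** The image of the unit matrix [delta_mx i j] has the positive diagonal entry of the Laplacian at
    [(i, j)]. Positivity matters because [|L|] is a divisor in the multiplier step and in [T]. *)
Lemma laplacian_opnorm_gt0 d (nu : 'I_m -> 'rV[R]_d -> R) :
  (1 <= d)%N -> (forall i, is_norm (nu i)) -> 0 < opnorm nu (laplacian R e).
Proof.
move=> d1 nu_norm; rewrite lt0r opnorm_ge0// andbT; apply/eqP => L0.
pose i := Ordinal (ltnW m_ge2); pose j := Ordinal d1.
have := opnorm_bound (laplacian R e) nu_norm (delta_mx i j).
rewrite L0 mul0r => h.
have : l2norm (laplacian R e *m delta_mx i j) = 0.
  by apply/eqP; rewrite eq_le h l2norm_ge0.
move=> /l2norm0_eq0/matrixP/(_ i j)/eqP; rewrite !mxE (bigD1 i)//= big1.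
  by rewrite [delta_mx _ _ _ _]mxE !eqxx mulr1 addr0 gt_eqF// laplacian_diag_gt0.
by move=> k ki; rewrite [delta_mx _ _ _ _]mxE (negbTE ki) mulr0.
Qed.

End Laplacian.

(** * Convexity *)

Section ConvexCombinations.
Variables (R : realType) (d : nat).
Implicit Types (X : set 'rV[R]_d) (f : 'rV[R]_d -> R).

Lemma convex_set_comb X x y (s : R) : convex_set X -> X x -> X y ->
  0 <= s -> s <= 1 -> X (s *: x + (1 - s) *: y).
Proof.
move=> cX Xx Xy s0 s1.
have s01 : Itv.spec (@Itv.num_sem R) (Itv.Real `[0%Z, 1%Z]) s.
  by rewrite /Itv.spec /= /Itv.num_sem /= in_itv/= num_real s0 s1.
by have := cX x y (Itv.mk s01) (mem_set Xx) (mem_set Xy); rewrite inE.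
Qed.

Lemma convex_function_comb X f x y (s : R) : convex_function X f -> X x -> X y ->
  0 <= s -> s <= 1 -> f (s *: x + (1 - s) *: y) <= s * f x + (1 - s) * f y.
Proof.
move=> cf Xx Xy s0 s1.
have s01 : Itv.spec (@Itv.num_sem R) (Itv.Real `[0%Z, 1%Z]) s.
  by rewrite /Itv.spec /= /Itv.num_sem /= in_itv/= num_real s0 s1.
by have := cf (Itv.mk s01) x y (mem_set Xx) (mem_set Xy).
Qed.

Definition convex_on X f := forall x y (s : R), X x -> X y -> 0 <= s -> s <= 1 ->
  f (s *: x + (1 - s) *: y) <= s * f x + (1 - s) * f y.

(** Adding a point writes the new average as a convex combination of the old average, with weight
    [S / (S + a)], and the new point; membership of the average in [X] therefore travels in the same
    induction. Multiplying by [S] keeps the inequality additive. *)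
Lemma jensen X f (a : nat -> R) (z : nat -> 'rV[R]_d) n :
  convex_set X -> convex_on X f -> (1 <= n)%N ->
  (forall t, (1 <= t <= n)%N -> 0 < a t /\ X (z t)) ->
  let S := \sum_(1 <= t < n.+1) a t in
  let zbar := S^-1 *: \sum_(1 <= t < n.+1) a t *: z t in
  [/\ 0 < S, X zbar & S * f zbar <= \sum_(1 <= t < n.+1) a t * f (z t)].
Proof.
move=> cX cf; elim: n => // -[_ _|n IHn _] h /=.
  have [a1 Xz] := h 1%N isT.
  by rewrite !big_nat1 scalerA mulVf ?gt_eqF// scale1r.
have [|S0 Xz fz] := IHn isT; first by move=> t tn; apply: h; lia.
have [an Xn] : 0 < a n.+2 /\ X (z n.+2) by apply: h; lia.
rewrite ![\sum_(1 <= t < n.+3) _]big_nat_recr//=.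
move: S0 Xz fz; set S := \sum_(_ <= _ < _) a _; set W := \sum_(_ <= _ < _) _ *: _.
set Y := \sum_(_ <= _ < _) _ * _ => S0 Xz fz.
have S1 : 0 < S + a n.+2 by rewrite addr_gt0.
have s0 : 0 <= S / (S + a n.+2) by rewrite divr_ge0// ltW.
have s1 : S / (S + a n.+2) <= 1 by rewrite ler_pdivrMr// mul1r lerDl ltW.
have e : (S + a n.+2)^-1 *: (W + a n.+2 *: z n.+2) =
  (S / (S + a n.+2)) *: (S^-1 *: W) + (1 - S / (S + a n.+2)) *: z n.+2.
  rewrite scalerDr !scalerA; congr (_ *: _ + _ *: _); field; rewrite ?gt_eqF//.
split => //; rewrite e; first exact: convex_set_comb.
have := cf _ _ _ Xz Xn s0 s1; rewrite -(ler_pM2l S1) => /le_trans; apply.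
rewrite [leLHS](_ : _ = S * f (S^-1 *: W) + a n.+2 * f (z n.+2)) ?lerD2r//.
by field; rewrite gt_eqF.
Qed.

Lemma convex_onD X f g : convex_on X f -> convex_on X g ->
  convex_on X (fun z => f z + g z).
Proof. by move=> cf cg x y s *; rewrite !mulrDr addrACA lerD ?cf ?cg. Qed.

Lemma convex_dot X w : convex_on X (dot w).
Proof. by move=> x y s *; rewrite dotDr !dotZr. Qed.

(** The triangle inequality bounds the norm by [s q + (1 - s) r], whose square lies below the chord
    of the squares by [s (1 - s) (q - r)^2]. *)
Lemma convex_nu_sq X nu (c : R) (a : 'rV[R]_d) : is_norm nu -> 0 <= c ->
  convex_on X (fun z => c * nu (a - z) ^+ 2).
Proof.
move=> nn c0 x y s _ _ s0 s1.
have -> : a - (s *: x + (1 - s) *: y) = s *: (a - x) + (1 - s) *: (a - y).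
  by apply/matrixP => i j; rewrite !mxE; ring.
have := norm_triangle nn (s *: (a - x)) ((1 - s) *: (a - y)).
have s2 : 0 <= 1 - s by lra.
rewrite !(norm_homogeneous nn) !ger0_norm//.
have := nu_ge0 nn (s *: (a - x) + (1 - s) *: (a - y)).
move: (nu (_ + _)) (nu (a - x)) (nu (a - y)) => p q r p0 h.
have : p ^+ 2 <= (s * q + (1 - s) * r) ^+ 2.
  by rewrite ler_pXn2r// nnegrE (le_trans p0 h).
have : 0 <= s * (1 - s) * (q - r) ^+ 2.
  by apply: mulr_ge0; [exact: mulr_ge0|exact: sqr_ge0].
move=> h1 h2; rewrite ![_ * (c * _)]mulrCA -mulrDr ler_wpM2l//; nra.
Qed.

End ConvexCombinations.

(** Prox-functions are differentiable only relative to [X], which along a segment means an expansion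
    with increments inside [[0, 1]], one-sided at the ends. This is enough for continuity on
    [[0, 1]] and a derivative in the interior, hence for monotonicity. *)
Lemma nonneg_slope_le (R : realType) (phi l : R -> R) :
  (forall s : R, 0 <= s <= 1 -> forall eps : R, 0 < eps -> exists2 del : R, 0 < del &
     forall r : R, 0 <= r <= 1 -> `|s - r| < del ->
       `|phi r - phi s - l s * (r - s)| <= eps * `|r - s|) ->
  (forall s : R, 0 < s < 1 -> 0 <= l s) -> phi 0 <= phi 1.
Proof.
move=> hd hl.
have der (s : R) : s \in `]0, 1[%R -> is_derive s 1 phi (l s).
  rewrite in_itv/= => /andP[s0 s1].
  have lim : (fun h => h^-1 *: ((phi \o shift s) (h *: 1) - phi s)) @ 0^' --> l s.
    apply/cvgrPdist_le => eps eps0.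
    have [|del del0 hdel] := hd s _ eps eps0; first by rewrite !ltW.
    near=> h.
    have h0 : h != 0 by near: h; exact: nbhs_dnbhs_neq.
    have hs : `|h| < Num.min del (Num.min s (1 - s)).
      by near: h; apply: dnbhs0_lt; rewrite !lt_min del0 s0 subr_gt0.
    move: hs; rewrite !lt_min => /and3P[hd1 hd2 hd3].
    have hr : 0 <= h + s <= 1.
      by move: hd2 hd3; rewrite !ltr_norml => /andP[? ?] /andP[? ?]; lra.
    have := hdel _ hr; rewrite opprD addrCA subrr addr0 normrN => /(_ hd1).
    rewrite /= [h%:A]mulr1 addrK => H.
    have hp : 0 < `|h| by rewrite normr_gt0.
    rewrite distrC -(ler_pM2r hp) -normrM mulrBl.
    by rewrite [_ *: _]/(_ * _) mulrAC mulVf// mul1r.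
  have dphi : derivable phi s 1 by apply/cvg_ex; exists (l s).
  by apply: DeriveDef => //; exact: (cvg_lim _ lim).
have cont : {within `[0, 1], continuous phi}.
  apply/subspace_continuousP => s; rewrite /= in_itv/= => s01.
  apply/cvgrPdist_lt => eps eps0.
  have [del del0 hdel] := hd s s01 1 ltr01.
  have K0 : 0 < 1 + `|l s| + 1 by rewrite ltr_wpDl// addr_ge0.
  exists (Num.min del (eps / (1 + `|l s| + 1))) => /=.
    by rewrite lt_min del0 divr_gt0.
  move=> r /=; rewrite lt_min in_itv/= => /andP[rd re] r01.
  have := hdel r r01 rd; rewrite mul1r => H.
  have -> : phi s - phi r = - ((phi r - phi s - l s * (r - s)) + l s * (r - s)) by ring.
  rewrite normrN (le_lt_trans (ler_normD _ _))// normrM.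
  rewrite (distrC r s) in H *.
  have H2 : `|s - r| * (1 + `|l s| + 1) < eps by rewrite -ltr_pdivlMr.
  have : 0 <= `|s - r| by [].
  nra.
have := ger0_derive1_le_cc (fun s sI => @ex_derive _ _ _ _ _ _ _ (der s sI)) _ cont.
apply; rewrite ?in_itv/= ?lexx ?ler01//.
move=> s sI; rewrite derive1E (@derive_val _ _ _ _ _ _ _ (der s sI)).
by apply: hl; move: sI; rewrite in_itv.
Unshelve. all: by end_near.
Qed.

(** * Prox-functions *)

Section Prox.
Variables (R : realType) (d : nat) (X : set 'rV[R]_d) (nu om : 'rV[R]_d -> R).
Variable gom : 'rV[R]_d -> 'rV[R]_d.
Hypotheses (nu_norm : is_norm nu) (cX : convex_set X) (pom : prox_function X nu om gom).
Local Notation V := (bregman om gom).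

Lemma prox_differentiable x : X x -> forall eps : R, 0 < eps -> exists2 del : R, 0 < del &
  forall u, X u -> `|x - u| < del ->
    `|om u - om x - dot (gom x) (u - x)| <= eps * `|u - x|.
Proof.
move=> Xx eps eps0; have /nbhs_ballP[del /= del0 h] := (prox_C1 pom).2 x Xx eps eps0.
by exists del => // u Xu xu; apply: h => //; rewrite -ball_normE.
Qed.

Lemma prox_gradient_continuous x : X x -> forall eps : R, 0 < eps ->
  exists2 del : R, 0 < del &
  forall u, X u -> `|x - u| < del -> `|gom x - gom u| < eps.
Proof.
move=> Xx eps eps0.
have /subspace_continuousP/(_ x Xx (ball (gom x) eps) (nbhsx_ballx _ _ eps0)) := (prox_C1 pom).1.
move=> /nbhs_ballP[del /= del0 h].
exists del => // u Xu xu.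
have : ball (gom x) eps (gom u) by apply: h => //; rewrite -ball_normE.
by rewrite -ball_normE.
Qed.

(** Along the segment [p s], [phi] is [om] minus the linear part of its expansion at [x] and minus
    [s^2 K / 2]. Strong monotonicity between [p s] and [x] makes its slope nonnegative, and
    [phi 0 <= phi 1] is the claim. *)
Lemma bregman_lower x u : X x -> X u -> nu (x - u) ^+ 2 / 2 <= V x u.
Proof.
move=> Xx Xu; set K := nu (x - u) ^+ 2.
pose p (s : R) := x + s *: (u - x).
have Xp s : 0 <= s <= 1 -> X (p s).
  move=> /andP[s0 s1]; have := convex_set_comb cX Xu Xx s0 s1.
  by congr X; apply/matrixP => i j; rewrite !mxE; ring.
have pB r s : p r - p s = (r - s) *: (u - x).
  by apply/matrixP => i j; rewrite !mxE; ring.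
pose phi s := om (p s) - s * dot (gom x) (u - x) - s ^+ 2 / 2 * K.
pose l s := dot (gom (p s)) (u - x) - dot (gom x) (u - x) - s * K.
suff : phi 0 <= phi 1.
  rewrite /phi /p !(mul0r, scale0r, addr0, expr0n, scale1r, mul1r, expr1n, subr0)/=.
  by rewrite /bregman addrCA subrr addr0; lra.
have K0 : 0 <= K by exact: sqr_ge0.
apply: (nonneg_slope_le (l := l)) => [s s01 eps eps0|s /andP[s0 s1]].
  have C0 : 0 < `|u - x| + 1 by rewrite ltr_wpDl.
  (* Half of [eps] pays for the differentiability error of [om], the other half for
     [(r - s)^2 K / 2], the exact remainder of the quadratic term. *)
  have [|del del0 h] := prox_differentiable (Xp s s01) (eps := eps / (2 * (`|u - x| + 1))).
    by rewrite divr_gt0// mulr_gt0.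
  exists (Num.min (del / (`|u - x| + 1)) (eps / (K + 1))).
    by rewrite lt_min !divr_gt0// ltr_wpDl.
  move=> r r01; rewrite lt_min ltr_pdivlMr// ltr_pdivlMr ?ltr_wpDl// => /andP[h1 h2].
  have := h _ (Xp r r01); rewrite !pB !normrZ dotZr => /(_ _).
  have -> : phi r - phi s - l s * (r - s) =
     (om (p r) - om (p s) - (r - s) * dot (gom (p s)) (u - x)) - (r - s) ^+ 2 / 2 * K.
    by rewrite /phi /l; field.
  move=> H; have /H{}H : `|s - r| * `|u - x| < del.
    by apply: le_lt_trans h1; rewrite ler_wpM2l// lerDl.
  rewrite (le_trans (ler_normB _ _))//.
  have -> : eps * `|r - s| = eps / 2 * `|r - s| + eps / 2 * `|r - s| by field.
  apply: lerD.
    apply: (le_trans H); rewrite -subr_ge0.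
    have -> : eps / 2 * `|r - s| - eps / (2 * (`|u - x| + 1)) * (`|r - s| * `|u - x|) =
      eps * `|r - s| / (2 * (`|u - x| + 1)) by field; rewrite gt_eqF.
    by rewrite divr_ge0// mulr_ge0// ltW.
  rewrite normrM (ger0_norm K0) ger0_norm ?divr_ge0 ?sqr_ge0//.
  rewrite -(real_normK (num_real (r - s))) distrC; move: h2 K0.
  have : 0 <= `|s - r| by [].
  move: `|s - r| => a a0; nra.
have Xps : X (p s) by apply: Xp; rewrite !ltW.
have := prox_strongly_monotone pom Xps Xx.
have -> : p s - x = s *: (u - x) by rewrite /p addrAC subrr add0r.
rewrite (norm_homogeneous nu_norm) exprMn real_normK ?num_real// (nuB nu_norm) -/K.
by rewrite dotZr dotBl expr2 -mulrA ler_pM2l// /l subr_ge0.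
Qed.

Lemma bregman_ge0 x u : X x -> X u -> 0 <= V x u.
Proof.
by move=> Xx Xu; apply: le_trans (bregman_lower Xx Xu); rewrite divr_ge0// sqr_ge0.
Qed.

(** If the pairing [A] were negative, a short step from [u] towards [v] would change the objective
    by [s A] plus a remainder of at most [s c eps]. With [eps = - A / (c + 1)] the total is at most
    [s A / (c + 1) < 0], against minimality. *)
Lemma argmin_first_order g a b x0 x1 u v : 0 <= a + b ->
  is_argmin X (fun z => dot g z + a * V x0 z + b * V x1 z) u -> X v ->
  0 <= dot (g - a *: gom x0 - b *: gom x1 + (a + b) *: gom u) (v - u).
Proof.
move=> ab [Xu umin] Xv; set A := dot _ _; rewrite leNgt; apply/negP => A0.
pose c := (a + b) * `|v - u|.
have c0 : 0 <= c by rewrite mulr_ge0.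
have [|del del0 h] := prox_differentiable Xu (eps := - A / (c + 1)).
  by rewrite divr_gt0 ?oppr_gt0// ltr_wpDl.
have C0 : 0 < `|v - u| + 1 by rewrite ltr_wpDl.
pose s := Num.min 1 (del / (`|v - u| + 1) / 2).
have s0 : 0 < s by rewrite lt_min ltr01 !divr_gt0.
have s1 : s <= 1 by rewrite ge_min lexx.
have sdel : s * `|v - u| < del.
  have : s * (`|v - u| + 1) <= del / 2.
    by rewrite -ler_pdivlMr// mulrAC ge_min lexx orbT.
  by rewrite mulrDr mulr1; lra.
pose p := u + s *: (v - u).
have Xp : X p.
  have := convex_set_comb cX Xv Xu (ltW s0) s1.
  by congr X; apply/matrixP => i j; rewrite !mxE; ring.
have pu : p - u = s *: (v - u) by rewrite /p addrAC subrr add0r.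
have := h p Xp; rewrite distrC pu normrZ gtr0_norm// => /(_ sdel).
rewrite dotZr => /ler_normlP[_ h1].
have := umin p Xp; rewrite -subr_ge0 => h2.
have e : dot g p + a * V x0 p + b * V x1 p - (dot g u + a * V x0 u + b * V x1 u)
  = s * A + (a + b) * (om p - om u - s * dot (gom u) (v - u)).
  have -> : p = u + s *: (v - u) by [].
  rewrite /bregman /A !(dotDl, dotDr, dotBr, dotBl, dotZl, dotZr, dotNl, dotNr).
  by ring.
rewrite e in h2.
have h3 : (a + b) * (om p - om u - s * dot (gom u) (v - u)) <= s * (c * (- A / (c + 1))).
  apply: (le_trans (ler_wpM2l ab h1)).
  by rewrite /c le_eqVlt; apply/orP; left; apply/eqP; ring.
have : 0 <= s * (A + c * (- A / (c + 1))) by rewrite mulrDr; lra.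
rewrite pmulr_rge0// => h4.
have c1 : 0 < c + 1 by rewrite ltr_wpDl.
have : A + c * (- A / (c + 1)) = A / (c + 1) by field; rewrite gt_eqF.
move=> h5; move: h4; rewrite h5 leNgt => /negP; apply.
by rewrite pmulr_llt0 ?invr_gt0.
Qed.

(** The difference of the two sides is exactly the pairing of [argmin_first_order]: this is the
    three-point identity of Bregman distances. *)
Lemma three_point g a b x0 x1 u v : 0 <= a + b ->
  is_argmin X (fun z => dot g z + a * V x0 z + b * V x1 z) u -> X v ->
  dot g (u - v) + a * V x0 u + b * V x1 u + (a + b) * V u v <= a * V x0 v + b * V x1 v.
Proof.
move=> ab um Xv; have := argmin_first_order ab um Xv; rewrite -subr_ge0 -[in X in _ -> X]subr_ge0.
congr (0 <= _); rewrite /bregman !(dotDl, dotDr, dotBr, dotBl, dotZl, dotZr, dotNl, dotNr).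
by ring.
Qed.

(** Adding the two optimality conditions, strong monotonicity of [gom] gives [(a + b) nu(u - u')^2
    <= dot (z - z') (u' - u)] for the aggregated data [z] and [z']. This is the route to
    measurability of the iterates. *)
Lemma argmin_lip a b : 0 < a + b -> exists2 C, 0 < C &
  forall g g' x0 x0' x1 x1' u u',
  is_argmin X (fun z => dot g z + a * V x0 z + b * V x1 z) u ->
  is_argmin X (fun z => dot g' z + a * V x0' z + b * V x1' z) u' ->
  `|u - u'| <= C * `|(g - a *: gom x0 - b *: gom x1) - (g' - a *: gom x0' - b *: gom x1')|.
Proof.
move=> ab.
have [C1 C10 h1] := norm_le_nu nu_norm; have [C2 C20 h2] := dual_norm_le_norm nu_norm.
exists (C1 * ((a + b)^-1 * C2)) => [|g g' x0 x0' x1 x1' u u' um um'].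
  by rewrite !mulr_gt0// invr_gt0.
have := argmin_first_order (ltW ab) um um'.1.
have := argmin_first_order (ltW ab) um' um.1.
move: (g - _ - _) (g' - _ - _) => z z' H' H.
apply: (le_trans (h1 _)); rewrite -!mulrA ler_wpM2l ?(ltW C10)//.
apply: (@le_trans _ _ ((a + b)^-1 * dual_norm nu (z - z'))); last first.
  by rewrite ler_wpM2l ?h2// invr_ge0 ltW.
rewrite ler_pdivlMl//.
have [->|n0] := eqVneq (nu (u - u')) 0; first by rewrite mulr0 dual_norm_ge0.
have n1 : 0 < nu (u - u') by rewrite lt0r n0 nu_ge0.
rewrite -(ler_pM2r n1) -mulrA -expr2.
have := dot_le_dual nu_norm (z - z') (u' - u); rewrite (nuB nu_norm u').
have := ler_wpM2l (ltW ab) (prox_strongly_monotone pom um.1 um'.1); move: H H'.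
rewrite !(dotDl, dotDr, dotBr, dotBl, dotZl, dotZr, dotNl, dotNr); lra.
Qed.

End Prox.

Section InnerStep.
Variables (R : realType) (d : nat) (X : set 'rV[R]_d) (nu om : 'rV[R]_d -> R).
Variables (gom : 'rV[R]_d -> 'rV[R]_d) (f : 'rV[R]_d -> R) (f' : 'rV[R]_d -> 'rV[R]_d) (M : R).
Hypotheses (nu_norm : is_norm nu) (cX : convex_set X) (pom : prox_function X nu om gom).
Hypothesis fobj : objective X nu 0 M f f'.
Local Notation V := (bregman om gom).

Lemma objective_lower x y : X x -> X y -> f y + dot (f' y) (x - y) <= f x.
Proof. by move=> Xx Xy; exact: (objective_subgradient fobj Xy). Qed.

Lemma objective_upper x y : X x -> X y -> f x <= f y + dot (f' y) (x - y) + M * nu (x - y).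
Proof. by move=> Xx Xy; have /andP[_] := objective_bounds fobj Xx Xy; lra. Qed.

(** The constant depends on [y] through [f' y]. Continuity of [f] at each point of [X] is what
    measurability of the objective asks for. *)
Lemma objective_lip y : X y -> exists2 C, 0 < C & forall x, X x -> `|f x - f y| <= C * `|x - y|.
Proof.
move=> Xy; have [C C0 hC] := nu_le_norm nu_norm.
exists ((1 * d)%:R * `|f' y| + `|M| * C + 1) => [|x Xx].
  by rewrite ltr_wpDl// addr_ge0// mulr_ge0// ltW.
have := objective_lower Xx Xy; have := objective_upper Xx Xy.
have h1 : M * nu (x - y) <= `|M| * C * `|x - y|.
  rewrite -mulrA (le_trans (ler_norm _))// normrM (ger0_norm (nu_ge0 nu_norm _)).
  by rewrite ler_wpM2l.
have h2 : 0 <= `|M| * C * `|x - y| by rewrite !mulr_ge0// ltW.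
have h3 : 0 <= `|x - y| by [].
have := dot_le_norm (f' y) (x - y); rewrite !ler_norml !mulrDl => /andP[]; lra.
Qed.

(* Young's inequality turns [(M + |del|) |u - u0|] into [b |u - u0|^2 / 2], absorbed by
   [b V(u0, u)], plus [(M + |del|)^2 / (2 b) <= (M^2 + |del|^2) / b]. *)
Lemma inner_step a b x0 u0 w h u v : 0 <= a -> 0 < b -> X u0 -> X v ->
  is_argmin X (fun z => dot (w + h) z + a * V x0 z + b * V u0 z) u ->
  dot w (u - v) + f u - f v + a * V x0 u + (a + b) * V u v <=
  a * V x0 v + b * V u0 v - dot (h - f' u0) (u0 - v) +
  (M ^+ 2 + dual_norm nu (h - f' u0) ^+ 2) / b.
Proof.
move=> a0 b0 Xu0 Xv um; have ab : 0 <= a + b by rewrite addr_ge0// ltW.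
have := three_point cX pom ab um Xv.
have Xu := um.1.
have := objective_upper Xu Xu0; have := objective_lower Xv Xu0.
have := dot_le_dual nu_norm (h - f' u0) (u0 - u); rewrite (nuB nu_norm u0 u).
set D := dual_norm nu _; set n := nu (u - u0).
have := ler_wpM2l (ltW b0) (bregman_lower nu_norm cX pom Xu0 Xu).
rewrite (nuB nu_norm) -/n => VV hD lo up tp.
have sq : (M + D) * n <= b * (n ^+ 2 / 2) + (M ^+ 2 + D ^+ 2) / b.
  have : 0 <= (b * n - (M + D)) ^+ 2 / (2 * b) + (M - D) ^+ 2 / (2 * b).
    by rewrite addr_ge0// divr_ge0 ?sqr_ge0// mulr_ge0// ltW.
  have -> : (b * n - (M + D)) ^+ 2 / (2 * b) + (M - D) ^+ 2 / (2 * b) =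
    b * (n ^+ 2 / 2) + (M ^+ 2 + D ^+ 2) / b - (M + D) * n.
    by field; rewrite gt_eqF.
  by rewrite subr_ge0.
move: lo up tp hD.
rewrite !(dotDl, dotDr, dotBr, dotBl, dotZl, dotZr, dotNl, dotNr); lra.
Qed.

End InnerStep.

(** * The deterministic estimates *)

Section InnerLoop.
Variables (R : realType) (d : nat) (X : set 'rV[R]_d) (nu om : 'rV[R]_d -> R).
Variables (gom : 'rV[R]_d -> 'rV[R]_d) (f : 'rV[R]_d -> R) (f' : 'rV[R]_d -> 'rV[R]_d) (M : R).
Hypotheses (nu_norm : is_norm nu) (cX : convex_set X) (pom : prox_function X nu om gom).
Hypothesis fobj : objective X nu 0 M f f'.
Local Notation V := (bregman om gom).
Variables (eta : R) (x0 w v : 'rV[R]_d) (T : nat) (h u : nat -> 'rV[R]_d).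
Hypotheses (eta_gt0 : 0 < eta) (Xx0 : X x0) (Xv : X v) (u0 : u 0%N = x0).
Hypothesis u_argmin : forall t, (1 <= t <= T)%N ->
  is_argmin X (fun z => dot (w + h t.-1) z + eta * V x0 z + eta * (t%:R / 2) * V (u t.-1) z)
    (u t).

(** The terms left over by [inner_step]: one linear in the oracle error, which has mean zero once
    randomness is restored, and the Young remainder with [b = eta beta_t]. *)
Definition step_noise t : R :=
  - dot (h t.-1 - f' (u t.-1)) (u t.-1 - v) +
  (M ^+ 2 + dual_norm nu (h t.-1 - f' (u t.-1)) ^+ 2) / (eta * (t%:R / 2)).

Lemma inner_mem t : (t <= T)%N -> X (u t).
Proof. by case: t => [|t] tT; [rewrite u0|have [] := u_argmin (t := t.+1) tT]. Qed.

Lemma inner_step_loop t : (t < T)%N ->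
  dot w (u t.+1 - v) + f (u t.+1) - f v + eta * V x0 (u t.+1) +
    (eta + eta * (t.+1%:R / 2)) * V (u t.+1) v <=
  eta * V x0 v + eta * (t.+1%:R / 2) * V (u t) v + step_noise t.+1.
Proof.
move=> tT; have tb : 0 < eta * (t.+1%:R / 2) by rewrite mulr_gt0// divr_gt0.
have := inner_step nu_norm cX pom fobj (ltW eta_gt0) tb (inner_mem (ltnW tT)) Xv
  (u_argmin (t := t.+1) tT).
by rewrite /step_noise /= addrA.
Qed.

(* The sums telescope because [lambda_t (1 + beta_t) = lambda_(t+1) beta_(t+1)]
   for [lambda_t = t + 1] and [beta_t = t / 2]. *)
Lemma inner_sum n : (n <= T)%N ->
  \sum_(1 <= t < n.+1) (t%:R + 1) * (dot w (u t - v) + f (u t) - f v + eta * V x0 (u t)) +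
    eta * ((n%:R + 1) * (n%:R + 2) / 2) * V (u n) v <=
  eta * (\sum_(1 <= t < n.+1) (t%:R + 1) + 1) * V x0 v +
    \sum_(1 <= t < n.+1) (t%:R + 1) * step_noise t.
Proof.
elim: n => [_|n IHn nT].
  by rewrite !big_geq// u0 le_eqVlt; apply/orP; left; apply/eqP; field.
have := IHn (ltnW nT); rewrite ![\sum_(1 <= t < n.+2) _]big_nat_recr//=.
have l0 : 0 <= n.+1%:R + 1 :> R by rewrite addr_ge0.
have := ler_wpM2l l0 (inner_step_loop nT); rewrite -![n.+1%:R]natr1; lra.
Qed.

Lemma sum_weights n : \sum_(1 <= t < n.+1) (t%:R + 1) = n%:R * (n%:R + 3) / 2 :> R.
Proof.
elim: n => [|n IHn]; first by rewrite big_geq// !mul0r.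
by rewrite big_nat_recr//= IHn -natr1; field.
Qed.

(** The bound [eta V(x0, u t) >= eta / 2 * nu (x0 - u t) ^+ 2] is applied to each iterate; its right
    side is convex, so Jensen treats it together with [f] and the linear term. As
    [(T + 1) (T + 2) / 2 = L + 1], both remaining Bregman terms get the coefficient
    [eta (1 + 1 / L)], and consecutive outer iterations telescope. *)
Lemma inner_loop (L := \sum_(1 <= t < T.+1) (t%:R + 1) : R)
  (xhat := L^-1 *: \sum_(1 <= t < T.+1) (t%:R + 1) *: u t) : (1 <= T)%N ->
  X xhat /\
  dot w (xhat - v) + f xhat - f v + eta / 2 * nu (x0 - xhat) ^+ 2 +
    eta * (1 + L^-1) * V (u T) v <=
  eta * (1 + L^-1) * V x0 v + L^-1 * \sum_(1 <= t < T.+1) (t%:R + 1) * step_noise t.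
Proof.
move=> T1.
have cPhi : convex_on X (fun z => dot w z + f z + eta / 2 * nu (x0 - z) ^+ 2).
  apply: convex_onD; last by apply: convex_nu_sq => //; rewrite divr_ge0// ltW.
  apply: convex_onD; first exact: convex_dot.
  by move=> *; exact: (convex_function_comb (objective_convex fobj)).
have [|L0 Xxhat Jx] := jensen (a := fun t => t%:R + 1) (z := u) cX cPhi T1.
  by move=> t /andP[_ tT]; rewrite ltr_wpDl//; split => //; exact: inner_mem.
split => //; rewrite -/L in L0; rewrite -/L -/xhat in Xxhat Jx.
have := inner_sum (leqnn T).
have -> : (T%:R + 1) * (T%:R + 2) / 2 = L + 1 by rewrite /L sum_weights; field.
rewrite -/L; set W := \sum_(_ <= _ < _) _ * step_noise _ => H.
have H2 : L * (dot w xhat + f xhat + eta / 2 * nu (x0 - xhat) ^+ 2 - dot w v - f v) <=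
    \sum_(1 <= t < T.+1) (t%:R + 1) * (dot w (u t - v) + f (u t) - f v + eta * V x0 (u t)).
  rewrite -addrA mulrDr (le_trans (lerD Jx (lexx _)))//.
  rewrite /L mulr_suml -big_split/= !big_nat; apply: ler_sum => t /andP[t1 tT].
  rewrite -mulrDr ler_wpM2l ?addr_ge0// dotBr.
  have := bregman_lower nu_norm cX pom Xx0 (inner_mem tT).
  move=> /(ler_wpM2l (ltW eta_gt0)); lra.
rewrite -(ler_pM2l L0); move: H2 H; rewrite dotBr.
have -> : forall p q, L * (p + eta * (1 + L^-1) * q) = L * p + eta * (L + 1) * q :> R.
  by move=> p q; field; rewrite gt_eqF.
have -> : L * (eta * (1 + L^-1) * V x0 v + L^-1 * W) = eta * (L + 1) * V x0 v + W.
  by field; rewrite gt_eqF.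
lra.
Qed.

End InnerLoop.

(** * Coupling with the multiplier: telescoping over the outer iterations *)

Section OuterLoop.
Variables (R : realType) (m d : nat) (A : 'M[R]_m) (nu : 'I_m -> 'rV[R]_d -> R).
Hypotheses (nu_norm : forall i, is_norm (nu i)) (A_sym : A^T = A).
Local Notation nA := (opnorm nu A).
Local Notation pn := (primal_norm nu).
Hypothesis nA_gt0 : 0 < nA.
Variables (x xhat xtil y : nat -> 'M[R]_(m, d)) (xs : 'M[R]_(m, d)) (N : nat).
Hypotheses (xhat0 : xhat 0%N = x 0%N) (Axs : A *m xs = 0).
Hypothesis xtilE : forall k, (1 <= k <= N)%N -> xtil k = xhat k.-1 - x k.-2 + x k.-1.
Hypothesis yE : forall k, (1 <= k <= N)%N -> y k = y k.-1 + nA^-1 *: (A *m xtil k).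
Variables F W e : nat -> R.
Hypothesis W_ge0 : forall k, (k <= N)%N -> 0 <= W k.
Hypothesis primal_step : forall k, (1 <= k <= N)%N ->
  F k + dot (A *m y k) (xhat k - xs) + nA * pn (x k.-1 - xhat k) ^+ 2 + W k <= W k.-1 + e k.

(** [0.-1] is [0], so [p 0 = xhat 0 - x 0 = 0] and the telescoping starts from nothing. *)
Let p k := xhat k - x k.-1.

(** Since [A] is symmetric and kills [xs], the primal step pairs [A xhat] with [y k]. In the
    splitting [xhat k = xtil k + (p k - p k.-1)], the first part gives a Euclidean three-point
    identity because [A xtil k = nA (y k - y k.-1)]; the second is the coupling term. *)
Lemma outer_step k z : (1 <= k <= N)%N ->
  F k + dot (A *m xhat k) z + W k + nA / 2 * l2norm (y k - z) ^+ 2 <=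
  W k.-1 + e k + nA / 2 * l2norm (y k.-1 - z) ^+ 2
  - nA / 2 * l2norm (y k - y k.-1) ^+ 2
  + dot (A *m (p k - p k.-1)) (z - y k) - nA * pn (p k) ^+ 2.
Proof.
move=> kN; have := primal_step kN.
have -> : x k.-1 - xhat k = - p k by rewrite opprB.
have -> : p k - p k.-1 = xhat k - xtil k.
  by rewrite xtilE// /p; apply/matrixP => i j; rewrite !mxE; ring.
have Axt : A *m xtil k = nA *: (y k - y k.-1).
  rewrite (yE kN) addrAC subrr add0r scalerA divff ?scale1r//.
  by rewrite gt_eqF.
rewrite -(scaleN1r (p k)) primal_normZ// normrN1 mul1r dot_mulmx A_sym.
rewrite mulmxBr Axs subr0 mulmxBr Axt !l2norm_sq.
rewrite !(dotDl, dotDr, dotBr, dotBl, dotZl, dotZr, dotNl, dotNr).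
rewrite (dotC _ (A *m xhat k)) (dotC (y k.-1) (y k)) (dotC z (y k)) (dotC z (y k.-1)).
lra.
Qed.

(** The coupling terms telescope once [z - y n] is replaced by [z - y n.+1]. The error
    [dot (A p_n) (y n.+1 - y n)] is split by Young between [nA |p_n|^2], kept in the induction
    hypothesis for this purpose, and the term [nA / 2 |y n.+1 - y n|^2] gained in the next step. *)
Lemma outer_sum n z : (n <= N)%N ->
  \sum_(1 <= k < n.+1) (F k + dot (A *m xhat k) z) + W n + nA / 2 * l2norm (y n - z) ^+ 2 <=
  W 0%N + nA / 2 * l2norm (y 0%N - z) ^+ 2 + \sum_(1 <= k < n.+1) e k
  + dot (A *m p n) (z - y n) - nA * pn (p n) ^+ 2.
Proof.
elim: n => [_|n IHn nN].
  rewrite !big_geq// /p /= xhat0 subrr mulmx0 dot0l.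
  by rewrite primal_norm0//; lra.
have := IHn (ltnW nN); rewrite !(big_nat_recr n.+1)//=.
have := outer_step z (k := n.+1) nN; rewrite /=.
have yz : z - y n = (z - y n.+1) + (y n.+1 - y n) by rewrite addrA subrK.
rewrite yz mulmxBr dotBl (dotDr (z - y n.+1)).
have h1 := dot_le_l2norm (A *m p n) (y n.+1 - y n).
have h2 := opnorm_bound A nu_norm (p n).
have h3 : l2norm (A *m p n) * l2norm (y n.+1 - y n) <=
    nA * (pn (p n) ^+ 2 / 2 + l2norm (y n.+1 - y n) ^+ 2 / 2).
  apply: (le_trans (ler_wpM2r (l2norm_ge0 _) h2)).
  rewrite -mulrA ler_wpM2l ?(ltW nA_gt0)//.
  have := sqr_ge0 (pn (p n) - l2norm (y n.+1 - y n)); lra.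
have h4 : 0 <= nA * pn (p n) ^+ 2 by rewrite mulr_ge0 ?sqr_ge0// ltW.
lra.
Qed.

(** The multiplier steps sum to [A] applied to the sum of the [xtil k], and the differences
    [xhat k - xtil k = p k - p k.-1] telescope. *)
Lemma dual_drift n : (n <= N)%N ->
  A *m (\sum_(1 <= k < n.+1) xhat k) = nA *: (y n - y 0%N) + A *m p n.
Proof.
elim: n => [_|n IHn nN].
  by rewrite big_geq// subrr scaler0 /p /= xhat0 subrr mulmx0 addr0.
rewrite big_nat_recr//= mulmxDr IHn ?(ltnW nN)//.
have kN : (1 <= n.+1 <= N)%N by [].
rewrite (yE kN) /= (addrAC (y n)) [in RHS]scalerDr scalerA divff ?gt_eqF// scale1r.
rewrite -!addrA; congr (_ + _); rewrite xtilE//= -!mulmxDr; congr (_ *m _).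
by rewrite /p; apply/matrixP => i j; rewrite !mxE /=; ring.
Qed.

Let S z := W 0%N + nA / 2 * l2norm (y 0%N - z) ^+ 2 + \sum_(1 <= k < N.+1) e k.

(** At [z = 0] the last coupling term is at most [nA |p_N| |y_N|], which is absorbed by
    [nA / 2 |y_N|^2] on the left and half of [nA |p_N|^2]. *)
Lemma outer_objective :
  \sum_(1 <= k < N.+1) F k <= S 0.
Proof.
have := outer_sum 0 (leqnn N).
under eq_bigr do rewrite dot0r addr0.
have h1 := dot_le_l2norm (A *m p N) (0 - y N).
have h2 := opnorm_bound A nu_norm (p N).
rewrite sub0r l2normN in h1; rewrite subr0 sub0r.
have h3 : l2norm (A *m p N) * l2norm (y N) <=
    nA * (pn (p N) ^+ 2 / 2 + l2norm (y N) ^+ 2 / 2).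
  apply: (le_trans (ler_wpM2r (l2norm_ge0 _) h2)).
  rewrite -mulrA ler_wpM2l ?(ltW nA_gt0)//.
  have := sqr_ge0 (pn (p N) - l2norm (y N)); lra.
have h4 : 0 <= nA * pn (p N) ^+ 2 by rewrite mulr_ge0 ?sqr_ge0// ltW.
have := W_ge0 (leqnn N); rewrite /S; lra.
Qed.

(* With [a = |p_N|] and [b = |y_N - z|], [S z] bounds [nA (b^2/2 - a b + a^2)],
   and [(a + b)^2 <= 10 (b^2/2 - a b + a^2)]. *)
Lemma outer_feasibility z (c : R) : 0 < c ->
  0 <= \sum_(1 <= k < N.+1) (F k + dot (A *m xhat k) z) ->
  l2norm (A *m (\sum_(1 <= k < N.+1) xhat k)) <=
  5 / c * S z + nA * (c / 2 + l2norm (z - y 0%N)).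
Proof.
move=> c0 sp; have := outer_sum z (leqnn N).
have h1 := dot_le_l2norm (A *m p N) (z - y N).
have h2 := opnorm_bound A nu_norm (p N).
have h3 := ler_wpM2r (l2norm_ge0 (z - y N)) h2.
have -> : l2norm (y N - z) = l2norm (z - y N) by rewrite -l2normN opprB.
move=> H; have W0 := W_ge0 (leqnn N).
set a := pn (p N) in h2 h3 H; set b := l2norm (z - y N) in h1 h3 H.
have quad : nA * (b ^+ 2 / 2 - a * b + a ^+ 2) <= S z by rewrite /S; lra.
have tri : l2norm (y N - y 0%N) <= b + l2norm (z - y 0%N).
  have -> : y N - y 0%N = - (z - y N) + (z - y 0%N).
    by apply/matrixP => i j; rewrite !mxE; ring.
  by rewrite (le_trans (l2norm_triangle _ _))// l2normN.
rewrite dual_drift// (le_trans (l2norm_triangle _ _))// l2normZ gtr0_norm//.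
(* The constant 10 comes from the exact sum of squares [10 (b^2/2 - a b + a^2) = (a + b)^2 + (3 a -
   2 b)^2]. *)
have ab : a + b <= 5 / c * (b ^+ 2 / 2 - a * b + a ^+ 2) + c / 2.
  rewrite -subr_ge0.
  have -> : 5 / c * (b ^+ 2 / 2 - a * b + a ^+ 2) + c / 2 - (a + b) =
    ((a + b - c) ^+ 2 + (3 * a - 2 * b) ^+ 2) / (2 * c).
    by field; rewrite gt_eqF.
  by rewrite divr_ge0 ?addr_ge0 ?sqr_ge0// mulr_ge0// ltW.
have := ler_wpM2l (ltW nA_gt0) tri; have := ler_wpM2l (ltW nA_gt0) ab.
have c5 : 0 <= 5 / c by rewrite divr_ge0// ltW.
have := ler_wpM2l c5 quad.
lra.
Qed.

End OuterLoop.

(** * Measurability of vector-valued functions *)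

Lemma open_borel_rV (R : realType) n (U : set 'rV[R]_n) :
  open U -> measurable (U : set (borel_rV R n)).
Proof. by move=> oU; exact: sub_sigma_algebra. Qed.

Section VectorMeasurability.
Variables (R : realType) (dT : measure_display) (T : measurableType dT).

(** The entrywise form suits the linear algebra of the method; [entry_measurable_borel] and
    [borel_entry_measurable] translate to and from the Borel structure in which the oracle and
    independence are expressed. *)
Definition entry_measurable p q (Y : T -> 'M[R]_(p, q)) : Prop :=
  forall i j, measurable_fun setT (fun o => Y o i j).

Lemma entry_measurable_cst p q (c : 'M[R]_(p, q)) : entry_measurable (fun=> c).
Proof. by move=> i j; exact: measurable_cst. Qed.

Lemma entry_measurableD p q (Y Z : T -> 'M[R]_(p, q)) :
  entry_measurable Y -> entry_measurable Z -> entry_measurable (fun o => Y o + Z o).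
Proof.
move=> mY mZ i j; under eq_fun do rewrite mxE.
by apply: measurable_funD; [exact: mY|exact: mZ].
Qed.

Lemma entry_measurableZ p q (a : R) (Y : T -> 'M[R]_(p, q)) :
  entry_measurable Y -> entry_measurable (fun o => a *: Y o).
Proof.
move=> mY i j; under eq_fun do rewrite mxE.
by apply: measurable_funM; [exact: measurable_cst|exact: mY].
Qed.

Lemma entry_measurableB p q (Y Z : T -> 'M[R]_(p, q)) :
  entry_measurable Y -> entry_measurable Z -> entry_measurable (fun o => Y o - Z o).
Proof.
move=> mY mZ; apply: entry_measurableD => //.
by under eq_fun do rewrite -scaleN1r; exact: entry_measurableZ.
Qed.

Lemma entry_measurable_sum p q (I : eqType) (r : seq I) (Y : I -> T -> 'M[R]_(p, q)) :
  (forall i, i \in r -> entry_measurable (Y i)) ->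
  entry_measurable (fun o => \sum_(i <- r) Y i o).
Proof.
elim: r => [_|i r IHr h].
  by under eq_fun do rewrite big_nil; exact: entry_measurable_cst.
under eq_fun do rewrite big_cons; apply: entry_measurableD.
  by apply: h; rewrite mem_head.
by apply: IHr => j jr; apply: h; rewrite in_cons jr orbT.
Qed.

Lemma entry_measurable_mulmx p q r (A : 'M[R]_(p, q)) (Y : T -> 'M[R]_(q, r)) :
  entry_measurable Y -> entry_measurable (fun o => A *m Y o).
Proof.
move=> mY i j; under eq_fun do rewrite mxE.
apply: measurable_sum => k.
by apply: measurable_funM; [exact: measurable_cst|exact: mY].
Qed.

Lemma entry_measurable_row p q (Y : T -> 'M[R]_(p, q)) i :
  entry_measurable Y -> entry_measurable (fun o => row i (Y o)).
Proof. by move=> mY k j; under eq_fun do rewrite mxE; exact: mY. Qed.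

Lemma entry_measurable_rows p q (Y : T -> 'M[R]_(p, q)) :
  (forall i, entry_measurable (fun o => row i (Y o))) -> entry_measurable Y.
Proof.
move=> mY i j; have := mY i ord0 j.
by congr measurable_fun; apply/funext => o; rewrite mxE.
Qed.

Lemma measurable_dot p q (Y Z : T -> 'M[R]_(p, q)) :
  entry_measurable Y -> entry_measurable Z -> measurable_fun setT (fun o => dot (Y o) (Z o)).
Proof.
move=> mY mZ; apply: measurable_sum => i; apply: measurable_sum => j.
by apply: measurable_funM; [exact: mY|exact: mZ].
Qed.

Lemma measurable_ball n (Y : T -> 'rV[R]_n) (c : 'rV[R]_n) (r : R) : 0 < r ->
  entry_measurable Y -> measurable (Y @^-1` ball c r).
Proof.
move=> r0 mY.
have -> : Y @^-1` ball c r =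
    \bigcap_(j in [set: 'I_n]) ((fun o => Y o ord0 j) @^-1` ball (c ord0 j) r).
  apply/seteqP; split => [ o [_ h] j _ | o h] /=; first exact: h.
  by split => // i j; rewrite ord1; exact: h.
apply: fin_bigcap_measurable => //= j _.
rewrite -[X in measurable X]setTI; apply: mY => //.
apply: open_measurable; exact: ball_open.
Qed.

Lemma entry_measurable_borel n (Y : T -> 'rV[R]_n) :
  entry_measurable Y -> measurable_fun setT (Y : T -> borel_rV R n).
Proof.
move=> mY; apply: (@measurability _ _ T (borel_rV R n) setT Y (@open 'rV[R]_n)) => //.
move=> _ [U oU <-]; rewrite setTI.
(* An open set is the union of the rational balls that it contains. *)
pose r (k : nat) : R := k.+1%:R^-1.
have r0 k : 0 < r k by rewrite /r invr_gt0.
pose c (q : 'rV[rat]_n) : 'rV[R]_n := map_mx ratr q.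
have -> : Y @^-1` U = \bigcup_(qk : 'rV[rat]_n * nat)
    (if `[< ball (c qk.1) (r qk.2) `<=` U >] then Y @^-1` ball (c qk.1) (r qk.2) else set0).
  apply/seteqP; split => [ o Uo|o [[q k] _] /=]; last by case: asboolP => // h /h.
  move: (oU); rewrite openE => /(_ _ Uo)/nbhs_ballP[e /= e0 eU].
  have [k] := ltr_add_invr (divr_gt0 e0 (ltr0Sn R 1)); rewrite add0r => ke.
  have /choice[q hq] : forall j, exists q : rat, ball (Y o ord0 j) (r k) (ratr q).
    move=> j; have : Y o ord0 j - r k < Y o ord0 j + r k by rewrite ltrBlDr -addrA ltrDl addr_gt0.
    move=> /rat_in_itvoo[q]; rewrite in_itv/= => hq; exists q.
    by rewrite -ball_normE/= ltr_distlC.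
  have b : ball (c (\row_j q j)) (r k) (Y o).
    by split => // i j; rewrite ord1 !mxE; apply: ball_sym; exact: hq.
  exists (\row_j q j, k) => //=; case: asboolP => // nU; exfalso; apply: nU => z bz; apply: eU.
  apply: (@le_ball _ _ _ (r k + r k)); first by rewrite [leRHS]splitr lerD// ltW.
  by apply: ball_triangle bz; apply: ball_sym.
apply: countable_bigcupT_measurable => // -[q k] /=; case: asboolP => // _.
exact: measurable_ball.
Qed.

Lemma borel_entry_measurable n (Y : T -> 'rV[R]_n) :
  measurable_fun setT (Y : T -> borel_rV R n) -> entry_measurable Y.
Proof.
move=> mY i j; rewrite ord1.
apply: (measurability _ (RGenOpens.measurableE R)) => _ [_ [a [b ->] <-]].
rewrite setTI.
have oU : open [set z : 'rV[R]_n | z ord0 j \in `]a, b[].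
  rewrite openE => z /= zab.
  have : nbhs (z ord0 j) `]a, b[%classic.
    by apply: open_nbhs_nbhs; split => //; exact: interval_open.
  move=> /nbhs_ballP[e /= e0 h]; apply/nbhs_ballP; exists e => //= z' [_ zz'].
  exact: h (zz' ord0 j).
have := mY measurableT _ (open_borel_rV oU); rewrite setTI.
by congr measurable.
Qed.

(* [u] factors as a continuous function of [z] on the range of [z], so the preimage of an
   open set under [u] is the preimage under [z] of an open set; the range of [z] itself
   need not be measurable. *)
Lemma measurable_modulus n (z : T -> 'rV[R]_n) (u : T -> R) : entry_measurable z ->
  (forall o (eps : R), 0 < eps -> exists2 del : R, 0 < del &
     forall o', `|z o - z o'| < del -> `|u o - u o'| < eps) ->
  measurable_fun setT u.
Proof.
move=> mz h; apply: (measurability _ (RGenOpens.measurableE R)) => _ [_ [a [b ->] <-]].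
rewrite setTI.
have /choice[del hdel] : forall o, exists del : R, u o \in `]a, b[ ->
    0 < del /\ forall o', `|z o - z o'| < del -> u o' \in `]a, b[.
  move=> o; have [uab|] := boolP (u o \in `]a, b[); last by exists 0.
  have : nbhs (u o) `]a, b[%classic.
    by apply: open_nbhs_nbhs; split => //; exact: interval_open.
  move=> /nbhs_ballP[e /= e0 he]; have [del del0 hd] := h o e e0.
  exists del => _; split => // o' /hd oo'; apply: he; by rewrite -ball_normE.
pose W := \bigcup_(o in [set o | u o \in `]a, b[]) ball (z o) (del o).
have oW : open W by apply: bigcup_open => o _; exact: ball_open.
have := entry_measurable_borel mz measurableT (open_borel_rV oW).
rewrite setTI; congr measurable; apply/seteqP; split => o /=.
  move=> [ o' uo' /=]; rewrite -ball_normE /= => oo'.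
  exact: (hdel o' uo').2.
by move=> uo; exists o => //; apply: ballxx; exact: (hdel o uo).1.
Qed.

Lemma measurable_modulus_rV n p q (z : T -> 'rV[R]_n) (u : T -> 'M[R]_(p, q)) :
  entry_measurable z ->
  (forall o (eps : R), 0 < eps -> exists2 del : R, 0 < del &
     forall o', `|z o - z o'| < del -> `|u o - u o'| < eps) ->
  entry_measurable u.
Proof.
move=> mz h i j; apply: (measurable_modulus mz) => o eps eps0.
have [del del0 hd] := h o eps eps0; exists del => // o' /hd; apply: le_lt_trans.
by have := ler_mx_entry (u o - u o') i j; rewrite !mxE.
Qed.

Lemma measurable_lip n (z : T -> 'rV[R]_n) (phi : 'rV[R]_n -> R) (C : R) : 0 < C ->
  (forall x y, `|phi x - phi y| <= C * `|x - y|) ->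
  entry_measurable z -> measurable_fun setT (fun o => phi (z o)).
Proof.
move=> C0 h mz; apply: (measurable_modulus mz) => o eps eps0.
exists (eps / C) => [|o' oo']; first exact: divr_gt0.
by apply: (le_lt_trans (h _ _)); rewrite mulrC -ltr_pdivlMr.
Qed.

End VectorMeasurability.

(** * Expectation and independence *)

Section Expectation.
Variables (R : realType) (dO : measure_display) (Omega : measurableType dO).
Variable P : probability Omega R.
Implicit Types Y Z : Omega -> R.

Lemma mean_at_mostD Y Z a b : mean_at_most P Y a -> mean_at_most P Z b ->
  mean_at_most P (fun o => Y o + Z o) (a + b).
Proof.
move=> [iY EY] [iZ EZ]; split; first exact: (integrableD measurableT iY iZ).
move: EY EZ; rewrite unlock => EY EZ.
by have := integralD_EFin measurableT iY iZ => /= ->; rewrite EFinD leeD.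
Qed.

Lemma integral_scale Y k : P.-integrable setT (EFin \o Y) ->
  P.-integrable setT (EFin \o (fun o => k * Y o)) /\
  ('E_P[fun o => (k * Y o)%R] = k%:E * 'E_P[Y])%E.
Proof.
move=> iY; split; first exact: (integrableZl measurableT k iY).
by rewrite unlock -integralZl.
Qed.

Lemma mean_at_mostZ Y a k : 0 <= k -> mean_at_most P Y a ->
  mean_at_most P (fun o => k * Y o) (k * a).
Proof.
move=> k0 [iY EY]; have [ikY EkY] := integral_scale k iY.
by split => //; rewrite EkY EFinM lee_wpmul2l.
Qed.

Lemma mean_at_most_cst c : mean_at_most P (cst c) c.
Proof.
split; last by rewrite expectation_cst.
by apply: finite_measure_integrable_cst.
Qed.

Lemma mean_at_mostW Y a b : a <= b -> mean_at_most P Y a -> mean_at_most P Y b.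
Proof. by move=> ab [iY EY]; split => //; rewrite (le_trans EY). Qed.

Lemma mean_at_most_sum (I : eqType) (r : seq I) (Y : I -> Omega -> R) (a : I -> R) :
  (forall i, i \in r -> mean_at_most P (Y i) (a i)) ->
  mean_at_most P (fun o => \sum_(i <- r) Y i o) (\sum_(i <- r) a i).
Proof.
elim: r => [_|i r IHr h].
  by under eq_fun do rewrite big_nil; rewrite big_nil; exact: mean_at_most_cst.
under eq_fun do rewrite big_cons; rewrite big_cons; apply: mean_at_mostD.
  by apply: h; rewrite mem_head.
by apply: IHr => j jr; apply: h; rewrite in_cons jr orbT.
Qed.

(* Domination does not require [Y] to be measurable. *)
Definition dominated Y := exists2 Z, P.-integrable setT (EFin \o Z) &
  forall o, `|Y o| <= Z o.

Lemma dominated_mean Y a : mean_at_most P Y a -> dominated Y.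
Proof.
move=> [iY _]; exists (fun o => `|Y o|) => //.
exact: (integrable_norm iY).
Qed.

Lemma dominated_cst c : dominated (cst c).
Proof. exact: dominated_mean (mean_at_most_cst c). Qed.

Lemma dominated_le Y Z : (forall o, `|Y o| <= `|Z o|) -> dominated Z -> dominated Y.
Proof. by move=> YZ [W iW ZW]; exists W => // o; rewrite (le_trans (YZ o)). Qed.

Lemma dominatedD Y Z : dominated Y -> dominated Z -> dominated (fun o => Y o + Z o).
Proof.
move=> [W iW YW] [W' iW' ZW]; exists (fun o => W o + W' o).
  exact: (integrableD measurableT iW iW').
by move=> o; rewrite (le_trans (ler_normD _ _))// lerD.
Qed.

Lemma dominatedZ Y k : dominated Y -> dominated (fun o => k * Y o).
Proof.
move=> [W iW YW]; exists (fun o => `|k| * W o).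
  exact: (integral_scale _ iW).1.
by move=> o; rewrite normrM ler_wpM2l.
Qed.

Lemma dominated_sum (I : eqType) (r : seq I) (Y : I -> Omega -> R) :
  (forall i, i \in r -> dominated (Y i)) -> dominated (fun o => \sum_(i <- r) Y i o).
Proof.
elim: r => [_|i r IHr h].
  by under eq_fun do rewrite big_nil; exact: dominated_cst.
under eq_fun do rewrite big_cons; apply: dominatedD.
  by apply: h; rewrite mem_head.
by apply: IHr => j jr; apply: h; rewrite in_cons jr orbT.
Qed.

Lemma dominated_integrable Y : measurable_fun setT Y -> dominated Y ->
  P.-integrable setT (EFin \o Y).
Proof.
move=> mY [Z iZ YZ]; apply: (le_integrable measurableT) iZ.
  exact/measurable_EFinP.
by move=> o _ /=; rewrite lee_fin (le_trans (YZ o))// ler_norm.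
Qed.

(** An upper bound leaves the negative part of [Y] unconstrained, so integrability has to come from
    domination. *)
Lemma mean_at_most_le Y Z a : measurable_fun setT Y -> dominated Y ->
  (forall o, Y o <= Z o) -> mean_at_most P Z a -> mean_at_most P Y a.
Proof.
move=> mY dY YZ [iZ EZ]; have iY := dominated_integrable mY dY; split => //.
apply: le_trans EZ; rewrite unlock; apply: le_integral => //.
by move=> o _; rewrite lee_fin.
Qed.

Lemma mean_at_most_dot n (Y : Omega -> 'rV[R]_n) (m c : 'rV[R]_n) : has_mean P Y m ->
  mean_at_most P (fun o => dot (Y o - m) c) 0.
Proof.
move=> hY; have h j : mean_at_most P (fun o => c ord0 j * Y o ord0 j - c ord0 j * m ord0 j) 0.
  have [iY EY] := hY j; have [icY EcY] := integral_scale (c ord0 j) iY.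
  rewrite -(subrr (c ord0 j * m ord0 j)); apply: mean_at_mostD; last exact: mean_at_most_cst.
  by split => //; rewrite EcY EY.
have := mean_at_most_sum (r := index_enum 'I_n) (fun j _ => h j); rewrite big1//.
congr (mean_at_most P _ 0); apply/funext => o; rewrite /dot big_ord1.
by apply: eq_bigr => j _; rewrite !mxE; ring.
Qed.

End Expectation.

(** * Fubini for an independent pair *)

Section ProductLaw.
Local Open Scope ereal_scope.
Variables (R : realType) (dO d1 d2 : measure_display) (Omega : measurableType dO).
Variables (P : probability Omega R) (T1 : measurableType d1) (T2 : measurableType d2).
Variables (Y : {RV P >-> T1}) (Z : {RV P >-> T2}).
Hypothesis indep : independent_rv P Z Y.

Let phi o := (Y o, Z o).

Let mphi : measurable_fun setT phi.
Proof. exact: measurable_fun_pair. Qed.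

HB.instance Definition _ := isMeasurableFun.Build _ _ _ _ phi mphi.

(** Independence is equality on rectangles, and these determine the product measure. *)
Let law (A : set (T1 * T2)) : measurable A ->
  (distribution P Y \x distribution P Z) A = pushforward P phi A.
Proof.
apply: product_measure_unique => A1 A2 mA1 mA2 /=.
by have := indep mA2 mA1; rewrite setIC muleC.
Qed.

(** The nonnegative form serves the variance, whose integrability is itself to be proved, and the
    absolute value of the integrand in the signed form. *)
Lemma integral_indep_ge0 (k : T1 * T2 -> \bar R) :
  measurable_fun setT k -> (forall p, 0 <= k p) ->
  \int[P]_o k (Y o, Z o) = \int[distribution P Y]_z \int[distribution P Z]_s k (z, s).
Proof.
move=> mk k0; rewrite -(fubini_tonelli1 k)//.
rewrite (@eq_measure_integral _ _ _ _ (pushforward P phi)).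
  by rewrite ge0_integral_pushforward.
by move=> A mA _; exact: law.
Qed.

Lemma integral_indep (k : T1 * T2 -> \bar R) :
  measurable_fun setT k -> P.-integrable setT (fun o => k (Y o, Z o)) ->
  (distribution P Y).-integrable setT (fun z => \int[distribution P Z]_s k (z, s)) /\
  \int[P]_o k (Y o, Z o) = \int[distribution P Y]_z \int[distribution P Z]_s k (z, s).
Proof.
move=> mk ik.
have ipk : (distribution P Y \x distribution P Z).-integrable setT k.
  apply/integrable12ltyP => //.
  have mak : measurable_fun setT (abse \o k) by exact: measurableT_comp.
  have := integral_indep_ge0 mak (fun p => abse_ge0 (k p)) => /= <-.
  by have /integrableP[] := ik.
split; first exact: integrable_fubini_F.
rewrite (integral12_prod_meas1 ipk).
rewrite (@eq_measure_integral _ _ _ _ (pushforward P phi)).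
  by rewrite integral_pushforward.
by move=> A mA _; exact: law.
Qed.

End ProductLaw.

(** * The stochastic oracle *)

Section Oracle.
Variables (R : realType) (d : nat) (X : set 'rV[R]_d) (nu : 'rV[R]_d -> R).
Variables (dO dXi : measure_display) (Omega : measurableType dO) (P : probability Omega R).
Variables (Xi : measurableType dXi) (G : 'rV[R]_d -> Xi -> 'rV[R]_d).
Variables (g : 'rV[R]_d -> 'rV[R]_d) (xi : {RV P >-> Xi}) (s2 : R).
Hypotheses (nu_norm : is_norm nu) (clX : closed X) (s2_ge0 : 0 <= s2).
Hypothesis mG : measurable_fun ((X `*` setT) : set (borel_rV R d * Xi))
  (fun z => G z.1 z.2 : borel_rV R d).
Hypothesis G_mean : forall z, X z -> has_mean P (fun o => G z (xi o)) (g z).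
Hypothesis G_var : forall z, X z ->
  mean_at_most P (fun o => dual_norm nu (G z (xi o) - g z) ^+ 2) s2.

Local Notation E := (borel_rV R d).
Local Notation Q := (distribution P xi).

Let measurable_X : measurable (X : set E).
Proof.
rewrite -[X](setCK X); apply: (@measurableC _ E).
by apply: open_borel_rV; rewrite openC.
Qed.

(** [G] is known to be measurable only over [X]; its extension by zero is measurable on the whole
    product, as Fubini requires. *)
Let GX j (p : E * Xi) : R := if `[< X p.1 >] then G p.1 p.2 ord0 j else 0.

Let measurable_GX j : measurable_fun setT (GX j).
Proof.
have mD : measurable (X `*` setT : set (E * Xi)) by exact: measurableX.
have eD : [set: E * Xi] `&` (fun p => `[< X p.1 >]) @^-1` [set true] = X `*` setT.
  rewrite setTI; apply/seteqP; split => p /=.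
    by move/asboolP => Xp; split.
  by move=> [Xp _]; apply/asboolP.
apply: measurable_fun_if => //.
  by apply: (measurable_fun_bool true); rewrite eD.
rewrite eD.
have mj : measurable_fun setT (fun z : E => (z : 'rV[R]_d) ord0 j : R).
  exact: (borel_entry_measurable (Y := fun z : E => z)).
exact: (measurableT_comp mj mG).
Qed.

Let gX j (z : E) : R := if `[< X z >] then g z ord0 j else 0.

(* [g] is measurable on [X] as the mean of the oracle; no measurability of the
   subgradient selection is assumed. *)
Let gXE j z : gX j z = fine (\int[Q]_s (GX j (z, s))%:E).
Proof.
rewrite /gX /GX /=; case: asboolP => Xz; last by rewrite integral0.
have [iG EG] := G_mean Xz j.
rewrite (integral_distribution (f := fun s => (G z s ord0 j)%:E)) //.
  by move: EG; rewrite unlock /= => ->.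
have := measurableT_comp (measurable_GX j) (pair1_measurable (z : E)).
rewrite /comp /GX /= asboolT//= => mz.
exact/measurable_EFinP.
Qed.

(** Tonelli gives measurable section integrals for nonnegative integrands, so the positive and
    negative parts are treated separately. *)
Let measurable_gX j : measurable_fun setT (gX j).
Proof.
have mk : measurable_fun setT (EFin \o GX j) by exact/measurable_EFinP.
have -> : gX j = fine \o (fun z => (\int[Q]_s (EFin \o GX j)^\+ (z, s) -
                                    \int[Q]_s (EFin \o GX j)^\- (z, s))%E).
  apply/funext => z; rewrite /= gXE; congr fine; rewrite integralE.
  by congr (_ - _)%E; apply: eq_integral => s _; rewrite !(funeposE, funenegE).
apply: measurableT_comp; first exact: fine_measurable.
apply: emeasurable_funB.
  by apply: measurable_fun_fubini_tonelli_F => //; exact: measurable_funepos.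
by apply: measurable_fun_fubini_tonelli_F => //; exact: measurable_funeneg.
Qed.

Let del (p : E * Xi) : 'rV[R]_d := \row_j (GX j p - gX j p.1).

Let delE z s : X z -> del (z, s) = G z s - g z.
Proof.
by move=> Xz; apply/rowP => j; rewrite !mxE /GX /gX /= asboolT.
Qed.

Let del0 z s : ~ X z -> del (z, s) = 0.
Proof.
by move=> Xz; apply/rowP => j; rewrite !mxE /GX /gX /= asboolF// subrr.
Qed.

Let measurable_del : entry_measurable del.
Proof.
move=> i j; under eq_fun do rewrite mxE.
apply: measurable_funB; first exact: measurable_GX.
exact: (measurableT_comp (measurable_gX j) measurable_fst).
Qed.

Let measurable_section (z : 'rV[R]_d) : entry_measurable (fun s => del (z, s)).
Proof.
move=> i j; exact: (measurableT_comp (measurable_del i j) (pair1_measurable (z : E))).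
Qed.

Variable U : Omega -> 'rV[R]_d.
Hypotheses (mU : entry_measurable U) (UX : forall o, X (U o)).
Hypothesis indep : independent_rv P xi (U : Omega -> E).

Let mU' : measurable_fun setT (U : Omega -> E).
Proof. exact: entry_measurable_borel. Qed.

Let UE : Omega -> E := U.
HB.instance Definition _ := isMeasurableFun.Build _ _ _ _ UE mU'.

Lemma measurable_oracle_error : entry_measurable (fun o => G (U o) (xi o) - g (U o)).
Proof.
have -> : (fun o => G (U o) (xi o) - g (U o)) = (fun o => del (UE o, xi o)).
  by apply/funext => o; rewrite delE.
move=> i j; apply: (measurableT_comp (measurable_del i j)).
exact: measurable_fun_pair.
Qed.

Lemma measurable_oracle : entry_measurable (fun o => G (U o) (xi o)).
Proof.
move=> i j; rewrite ord1.
have -> : (fun o => G (U o) (xi o) ord0 j) = (fun o => GX j (UE o, xi o)).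
  by apply/funext => o; rewrite /GX /= asboolT.
apply: (measurableT_comp (measurable_GX j)).
exact: measurable_fun_pair.
Qed.

Lemma measurable_dual_sq (dT : measure_display) (T : measurableType dT) (z : T -> 'rV[R]_d) :
  entry_measurable z -> measurable_fun setT (fun o => dual_norm nu (z o) ^+ 2).
Proof.
move=> mz; have [C C0 hC] := dual_norm_lip nu_norm.
exact: measurable_funX (measurable_lip C0 hC mz).
Qed.

(** By Tonelli the draw is integrated first, with the search point [z] frozen: (A2) bounds the inner
    integral by [s2] uniformly in [z]. The same finite bound yields integrability. *)
Lemma oracle_variance :
  mean_at_most P (fun o => dual_norm nu (G (U o) (xi o) - g (U o)) ^+ 2) s2.
Proof.
pose k (p : E * Xi) : \bar R := (dual_norm nu (del p) ^+ 2)%:E.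
have k0 p : (0 <= k p)%E by rewrite lee_fin sqr_ge0.
have mk : measurable_fun setT k.
  by apply/measurable_EFinP; exact: measurable_dual_sq.
have le_s2 : (\int[P]_o k (UE o, xi o) <= s2%:E)%E.
  rewrite (integral_indep_ge0 (Y := UE) indep mk k0).
  apply: (@le_trans _ _ (\int[distribution P UE]_z s2%:E)%E); last first.
    by rewrite integral_cst//= probability_setT mule1.
  apply: ge0_le_integral => //.
  - by move=> z _; apply: integral_ge0.
  - exact: measurable_fun_fubini_tonelli_F.
  move=> z _; have [Xz|nXz] := pselect (X z); last first.
    rewrite (eq_integral (fun=> 0%E)) ?integral0// => s _.
    rewrite /k del0// expr2 [X in (X * _)%:E](_ : _ = 0) ?mul0r//.
    by apply/eqP; rewrite eq_le dual_norm_ge0// andbT; apply: dual_norm_le => // x _; rewrite dot0l.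
  have [iV EV] := G_var Xz; apply: le_trans EV.
  rewrite ge0_integral_distribution//; last first.
    by apply/measurable_EFinP; exact: measurable_dual_sq.
  rewrite unlock le_eqVlt; apply/orP; left; apply/eqP.
  by apply: eq_integral => o _; rewrite /k /= delE.
have e : (fun o => dual_norm nu (G (U o) (xi o) - g (U o)) ^+ 2) =
         (fun o => dual_norm nu (del (UE o, xi o)) ^+ 2).
  by apply/funext => o; rewrite delE.
split; last by rewrite e unlock.
apply/integrableP; split.
  by apply/measurable_EFinP; apply: measurable_dual_sq; exact: measurable_oracle_error.
apply: le_lt_trans (ltry s2); apply: le_trans le_s2.
rewrite le_eqVlt; apply/orP; left; apply/eqP; apply: eq_integral => o _ /=.
by rewrite /k delE// ger0_norm// sqr_ge0.
Qed.

(** With the search point frozen, the inner integral is at most zero by (A1). Fubini first needs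
    integrability: the pairing is at most the sum of the squares of its two factors, controlled by
    [oracle_variance] and by the assumption on [U]. *)
Lemma oracle_unbiased v : dominated P (fun o => nu (U o - v) ^+ 2) ->
  mean_at_most P (fun o => - dot (G (U o) (xi o) - g (U o)) (U o - v)) 0.
Proof.
move=> dU.
pose k (p : E * Xi) : \bar R := (- dot (del p) ((p.1 : 'rV[R]_d) - v))%:E.
have mfst : entry_measurable (fun p : E * Xi => (p.1 : 'rV[R]_d)).
  move=> i j; have mj : measurable_fun setT (fun z : E => (z : 'rV[R]_d) i j : R).
    exact: (borel_entry_measurable (Y := fun z : E => z)).
  exact: (measurableT_comp mj measurable_fst).
have mk : measurable_fun setT k.
  apply/measurable_EFinP; apply: measurable_funN; apply: measurable_dot => //.
  by apply: entry_measurableB => //; exact: entry_measurable_cst.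
have ik : P.-integrable setT (fun o => k (UE o, xi o)).
  apply: (@dominated_integrable _ _ _ P (fun o => - dot (del (UE o, xi o)) (U o - v))).
    apply/measurable_EFinP; apply: (measurableT_comp mk).
    exact: measurable_fun_pair.
  apply: (@dominated_le _ _ _ P _
    (fun o => dual_norm nu (G (U o) (xi o) - g (U o)) ^+ 2 + nu (U o - v) ^+ 2)).
    move=> o; rewrite delE// normrN.
    set D := _ - g _; set z := U o - v.
    have := dot_le_dual nu_norm D z; have := dot_le_dual nu_norm D (- z).
    rewrite dotNr (nuN nu_norm) (ger0_norm (addr_ge0 (sqr_ge0 _) (sqr_ge0 _))) ler_norml.
    have := sqr_ge0 (dual_norm nu D - nu z); have := sqr_ge0 (dual_norm nu D + nu z).
    by move=> *; apply/andP; split; nra.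
  by apply: dominatedD => //; exact: dominated_mean oracle_variance.
have [iF eF] := integral_indep (Y := UE) indep mk ik.
have e : (fun o => - dot (G (U o) (xi o) - g (U o)) (U o - v)) =
         (fun o => - dot (del (UE o, xi o)) (UE o - v)).
  by apply/funext => o; rewrite delE.
rewrite e; split; first exact: ik.
rewrite unlock [leLHS]eF.
rewrite (_ : 0%:E = \int[distribution P UE]_z (cst 0%E z))%E; last by rewrite integral0.
apply: le_integral => //; first exact: integrable0.
move=> z _; have [Xz|nXz] := pselect (X z); last first.
  by rewrite (eq_integral (fun=> 0%E)) ?integral0// => s _; rewrite /k del0// dot0l oppr0.
have [iV EV] := mean_at_most_dot (- (z - v)) (G_mean Xz).
have eV : (fun o => dot (G z (xi o) - g z) (- (z - v))) = (fun o => - dot (del (z, xi o)) (z - v)).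
  by apply/funext => o; rewrite delE// dotNr.
rewrite eV in iV EV.
rewrite (integral_distribution (f := fun s => k (z, s))) //.
  by move: EV; rewrite unlock.
exact: (measurableT_comp mk (pair1_measurable (z : E))).
Qed.

End Oracle.

(** * Finite second moments of vector-valued quantities *)

Section SquareDominated.
Variables (R : realType) (dO : measure_display) (Omega : measurableType dO).
Variable P : probability Omega R.

Definition sq_dominated p q (Y : Omega -> 'M[R]_(p, q)) :=
  dominated P (fun o => `|Y o| ^+ 2).

Lemma sq_dominated_cst p q (c : 'M[R]_(p, q)) : sq_dominated (fun=> c).
Proof. exact: dominated_cst. Qed.

Lemma sq_dominated_le p q p' q' (Y : Omega -> 'M[R]_(p, q)) (Z : Omega -> 'M[R]_(p', q')) C :
  (forall o, `|Y o| <= C * `|Z o|) -> sq_dominated Z -> sq_dominated Y.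
Proof.
move=> h dZ; apply: dominated_le (dominatedZ (C ^+ 2) dZ) => o.
rewrite -exprMn !ger0_norm ?sqr_ge0// ler_pXn2r ?nnegrE//; exact: le_trans (h o).
Qed.

Lemma sq_dominatedD p q (Y Z : Omega -> 'M[R]_(p, q)) :
  sq_dominated Y -> sq_dominated Z -> sq_dominated (fun o => Y o + Z o).
Proof.
move=> dY dZ; apply: dominated_le (dominatedZ 2 (dominatedD dY dZ)) => o.
rewrite !ger0_norm ?sqr_ge0 ?mulr_ge0 ?addr_ge0 ?sqr_ge0//.
have := ler_normD (Y o) (Z o); have := normr_ge0 (Y o + Z o).
have := sqr_ge0 (`|Y o| - `|Z o|).
move: `|Y o| `|Z o| `|Y o + Z o| => a b c; nra.
Qed.

Lemma sq_dominatedZ p q (a : R) (Y : Omega -> 'M[R]_(p, q)) :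
  sq_dominated Y -> sq_dominated (fun o => a *: Y o).
Proof. by apply: sq_dominated_le => o; rewrite normrZ. Qed.

Lemma sq_dominatedB p q (Y Z : Omega -> 'M[R]_(p, q)) :
  sq_dominated Y -> sq_dominated Z -> sq_dominated (fun o => Y o - Z o).
Proof.
move=> dY dZ; apply: sq_dominatedD => //.
by apply: (sq_dominated_le (C := 1)) dZ => o; rewrite normrN mul1r.
Qed.

Lemma sq_dominated_sum p q (I : eqType) (r : seq I) (Y : I -> Omega -> 'M[R]_(p, q)) :
  (forall i, i \in r -> sq_dominated (Y i)) -> sq_dominated (fun o => \sum_(i <- r) Y i o).
Proof.
elim: r => [_|i r IHr h].
  by under eq_fun do rewrite big_nil; exact: sq_dominated_cst.
under eq_fun do rewrite big_cons; apply: sq_dominatedD.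
  by apply: h; rewrite mem_head.
by apply: IHr => j jr; apply: h; rewrite in_cons jr orbT.
Qed.

Lemma sq_dominated_mulmx p q r (A : 'M[R]_(p, q)) (Y : Omega -> 'M[R]_(q, r)) :
  sq_dominated Y -> sq_dominated (fun o => A *m Y o).
Proof.
apply: (sq_dominated_le (C := q%:R * `|A|)) => o; exact: norm_mulmx.
Qed.

Lemma sq_dominated_row p q (Y : Omega -> 'M[R]_(p, q)) i :
  sq_dominated Y -> sq_dominated (fun o => row i (Y o)).
Proof.
apply: (sq_dominated_le (C := 1)) => o; rewrite mul1r; exact: norm_row.
Qed.

Lemma sq_dominated_rows p q (Y : Omega -> 'M[R]_(p, q)) :
  (forall i, sq_dominated (fun o => row i (Y o))) -> sq_dominated Y.
Proof.
move=> h; have := dominated_sum (r := index_enum 'I_p) (fun i _ => h i).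
apply: dominated_le => o; rewrite !ger0_norm ?sqr_ge0 ?sumr_ge0//.
exact: norm_rows.
Qed.

End SquareDominated.

(** * The SDCS method *)

Section Sdcs.
Variables (R : realType) (m d : nat) (A : 'M[R]_m).
Variables (X : 'I_m -> set 'rV[R]_d) (nu : 'I_m -> 'rV[R]_d -> R).
Variables (f : 'I_m -> 'rV[R]_d -> R) (f' : 'I_m -> 'rV[R]_d -> 'rV[R]_d) (M : R).
Variables (om : 'I_m -> 'rV[R]_d -> R) (gom : 'I_m -> 'rV[R]_d -> 'rV[R]_d).
Variables (xstar ystar : 'M[R]_(m, d)).
Variables (dO : measure_display) (Omega : measurableType dO) (P : probability Omega R).
Variables (dXi : 'I_m -> measure_display) (Xi : forall i, measurableType (dXi i)).
Variables (G : forall i, 'rV[R]_d -> Xi i -> 'rV[R]_d) (sigma : R).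
Variables (xi : forall i, nat -> nat -> {RV P >-> Xi i}).
Variables (N T : nat) (x0 y0 : 'M[R]_(m, d)).
Variables (x xhat xtil y w : nat -> Omega -> 'M[R]_(m, d)).
Variables (h u : 'I_m -> nat -> nat -> Omega -> 'rV[R]_d).
Local Notation nA := (opnorm nu A).
Hypotheses (A_sym : A^T = A) (nA_gt0 : 0 < nA) (Axstar : A *m xstar = 0).
Hypotheses (clX : forall i, closed (X i)) (cX : forall i, convex_set (X i)).
Hypotheses (nu_norm : forall i, is_norm (nu i)).
Hypothesis fobj : forall i, objective (X i) (nu i) 0 M (f i) (f' i).
Hypothesis pom : forall i, prox_function (X i) (nu i) (om i) (gom i).
Hypothesis Xstar : prod_set X xstar.
Hypothesis mG : forall i, measurable_fun ((X i `*` setT) : set (borel_rV R d * Xi i))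
     (fun z => G z.1 z.2 : borel_rV R d).
Hypothesis unbiased : forall i k t z, (1 <= k <= N)%N -> (t < T)%N -> X i z ->
  has_mean P (fun o => G z (xi i k t o)) (f' i z).
Hypothesis variance : forall i k t z, (1 <= k <= N)%N -> (t < T)%N -> X i z ->
  mean_at_most P (fun o => dual_norm (nu i) (G z (xi i k t o) - f' i z) ^+ 2) (sigma ^+ 2).
Hypothesis indep : forall i k t, (1 <= k <= N)%N -> (t < T)%N ->
  independent_rv P (xi i k t) (u i k t : Omega -> borel_rV R d).
Hypotheses (T_ge1 : (1 <= T)%N) (Xx0 : prod_set X x0).
Hypothesis run : forall o, sdcs_run A X om gom G N
  (fun=> 1) (fun=> nA) (fun=> 2 * nA) (fun=> T) (fun t => t%:R + 1) (fun t => t%:R / 2)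
  x0 y0 (fun i k t => xi i k t o) (x^~ o) (xhat^~ o) (xtil^~ o) (y^~ o) (w^~ o)
  (fun i k t => h i k t o) (fun i k t => u i k t o).

Local Notation V i := (bregman (om i) (gom i)).
Local Notation eta := (2 * nA).
Local Notation v i := (row i xstar).

Let eta_gt0 : 0 < eta.
Proof. by rewrite mulr_gt0. Qed.

Let Xv i : X i (v i).
Proof. exact: Xstar. Qed.

(** Domination is carried for [V i (Y o) (v i)] and not for a squared norm: the prox step bounds the
    new Bregman distance by the old ones, and [bregman_lower] recovers the squared norm, whereas a
    prox-function need not admit a converse bound. *)
Definition iterate_ok i (Y : Omega -> 'rV[R]_d) :=
  [/\ entry_measurable Y, forall o, X i (Y o) & dominated P (fun o => V i (Y o) (v i))].

Lemma iterate_ok_nu i Y : iterate_ok i Y -> dominated P (fun o => nu i (Y o - v i) ^+ 2).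
Proof.
move=> [_ XY dV]; apply: dominated_le (dominatedZ 2 dV) => o.
have := bregman_lower (nu_norm i) (cX (i:=i)) (pom i) (XY o) (Xv i).
rewrite ger0_norm ?sqr_ge0// => hV; rewrite (le_trans _ (ler_norm _))//; lra.
Qed.

Lemma iterate_ok_sq i Y : iterate_ok i Y -> sq_dominated P Y.
Proof.
move=> okY; have [C C0 hC] := norm_le_nu (nu_norm i).
have dYv : sq_dominated P (fun o => Y o - v i).
  apply: dominated_le (dominatedZ (C ^+ 2) (iterate_ok_nu okY)) => o.
  have n0 := nu_ge0 (nu_norm i) (Y o - v i).
  by rewrite -exprMn !ger0_norm ?sqr_ge0// ler_pXn2r ?nnegrE ?mulr_ge0 ?(ltW C0).
have := sq_dominatedD dYv (sq_dominated_cst P (v i)).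
by congr sq_dominated; apply/funext => o; rewrite subrK.
Qed.

(** [gom i] is continuous only within [X i]; since [Y] stays in [X i], the modulus criterion applies
    to the composite. *)
Lemma iterate_ok_gradient i Y : iterate_ok i Y -> entry_measurable (fun o => gom i (Y o)).
Proof.
move=> [mY XY _]; apply: (measurable_modulus_rV mY) => o eps eps0.
have [del del0 hd] := prox_gradient_continuous (pom i) (XY o) eps0.
by exists del => // o' oo'; apply: hd.
Qed.

Section ProxStep.
Variables (i : 'I_m) (k t : nat).
Hypotheses (kN : (1 <= k <= N)%N) (tT : (1 <= t <= T)%N).
Hypothesis ok_u : iterate_ok i (u i k t.-1).

Let tT' : (t.-1 < T)%N.
Proof. by case: t tT => // s /andP[]. Qed.

Let hE o : h i k t.-1 o = G (u i k t.-1 o) (xi i k t.-1 o).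
Proof. exact: (sdcs_h (run o) i kN tT). Qed.

Let mu := let: And3 a _ _ := ok_u in a.
Let Xu := let: And3 _ b _ := ok_u in b.

Let mh : entry_measurable (h i k t.-1).
Proof.
have -> : h i k t.-1 = (fun o => G (u i k t.-1 o) (xi i k t.-1 o)).
  by apply/funext => o; exact: hE.
exact: (measurable_oracle (xi i k t.-1) (@clX i) (@mG i) mu Xu).
Qed.

Lemma noise_variance : mean_at_most P
  (fun o => dual_norm (nu i) (h i k t.-1 o - f' i (u i k t.-1 o)) ^+ 2) (sigma ^+ 2).
Proof.
under eq_fun do rewrite hE.
apply: (oracle_variance (nu_norm i) (@clX i) (sqr_ge0 _) (@mG i) _ _ mu Xu (@indep i _ _ kN tT')).
  by move=> z Xz; exact: unbiased.
by move=> z Xz; exact: variance.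
Qed.

Lemma noise_unbiased : mean_at_most P
  (fun o => - dot (h i k t.-1 o - f' i (u i k t.-1 o)) (u i k t.-1 o - v i)) 0.
Proof.
under eq_fun do rewrite hE.
apply: (oracle_unbiased (nu_norm i) (@clX i) (sqr_ge0 _) (@mG i) _ _ mu Xu (@indep i _ _ kN tT')
  (iterate_ok_nu ok_u)).
  by move=> z Xz; exact: unbiased.
by move=> z Xz; exact: variance.
Qed.

Hypothesis ok_x : iterate_ok i (fun o => row i (x k.-1 o)).
Hypotheses (mw : entry_measurable (w k)) (dw : sq_dominated P (w k)).

Let b := eta * (t%:R / 2).

Let b_gt0 : 0 < b.
Proof. by rewrite mulr_gt0// divr_gt0// ltr0n; case/andP: tT. Qed.

Let u_argmin o : is_argmin (X i)
  (fun z => dot (row i (w k o) + h i k t.-1 o) z + eta * V i (row i (x k.-1 o)) z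
            + b * V i (u i k t.-1 o) z) (u i k t o).
Proof. exact: (sdcs_u (run o) i kN tT). Qed.

Let m_u : entry_measurable (u i k t).
Proof.
have [C C0 hC] := argmin_lip (nu_norm i) (cX (i:=i)) (pom i) (addr_gt0 eta_gt0 b_gt0).
(* By [argmin_lip] the new iterate is a Lipschitz function of this vector. *)
pose z o := row i (w k o) + h i k t.-1 o - eta *: gom i (row i (x k.-1 o))
  - b *: gom i (u i k t.-1 o).
have mz : entry_measurable z.
  apply: entry_measurableB; last exact/entry_measurableZ/iterate_ok_gradient.
  apply: entry_measurableB; last exact/entry_measurableZ/iterate_ok_gradient.
  by apply: entry_measurableD; [exact: entry_measurable_row|exact: mh].
apply: (measurable_modulus_rV mz) => o eps eps0.
exists (eps / C) => [|o' oo']; first exact: divr_gt0.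
apply: (le_lt_trans (hC _ _ _ _ _ _ _ _ (u_argmin o) (u_argmin o'))).
by rewrite mulrC -ltr_pdivlMr.
Qed.

(* The oracle's output need not be integrable in the directions orthogonal to [X - X];
   only its error and the value [f u - f v >= dot (f' v) (u - v)] enter the bound. *)
Lemma prox_ok : iterate_ok i (u i k t).
Proof.
have Xu' o : X i (u i k t o) by have [] := u_argmin o.
split => //.
have [C C0 hC] := dual_norm_le_norm (nu_norm i).
(* With [n] the norm of [u - v], convexity at [v] gives [dot w (u - v) + f u - f v >= - E n]. Young
   against [eta V(u, v) >= eta n^2 / 2] costs [E^2 / (2 eta)], and [b V(u, v)] remains on the left
   to be bounded. *)
pose E o := dual_norm (nu i) (row i (w k o) + f' i (v i)).
have dE : dominated P (fun o => E o ^+ 2).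
  have := sq_dominatedD (sq_dominated_row i dw) (sq_dominated_cst P (f' i (v i))).
  move=> /(dominatedZ (C ^+ 2)); apply: dominated_le => o.
  have E0 : 0 <= E o by exact: (dual_norm_ge0 (nu_norm i)).
  have EC : E o <= C * `|row i (w k o) + f' i (v i)| by exact: hC.
  rewrite -exprMn !ger0_norm ?sqr_ge0// ler_pXn2r ?nnegrE//.
  exact: le_trans EC.
have dV0 : dominated P (fun o => V i (row i (x k.-1 o)) (v i)) by have [] := ok_x.
have dV1 : dominated P (fun o => V i (u i k t.-1 o) (v i)) by have [] := ok_u.
have dZ := dominatedZ b^-1 (dominatedD (dominatedD (dominatedD (dominatedD
  (dominatedZ eta dV0) (dominatedZ b dV1)) (dominated_mean noise_unbiased))
  (dominatedZ b^-1 (dominatedD (dominated_cst P (M ^+ 2)) (dominated_mean noise_variance))))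
  (dominatedZ (2 * eta)^-1 dE)).
apply: dominated_le dZ => o /=; rewrite /cst.
have Xx : X i (row i (x k.-1 o)) by have [_ + _] := ok_x; exact.
have := inner_step (nu_norm i) (cX (i:=i)) (pom i) (fobj i) (ltW eta_gt0) b_gt0
  (Xu o) (@Xv i) (u_argmin o).
set D := dual_norm _ _; rewrite -/(E o).
have V0 := bregman_ge0 (nu_norm i) (cX (i:=i)) (pom i) (Xu' o) (@Xv i).
have VL := bregman_lower (nu_norm i) (cX (i:=i)) (pom i) (Xu' o) (@Xv i).
have V2 := mulr_ge0 (ltW eta_gt0) (bregman_ge0 (nu_norm i) (cX (i:=i)) (pom i) Xx (Xu' o)).
have fl := objective_lower (fobj i) (Xu' o) (@Xv i).
have := dot_le_dual (nu_norm i) (row i (w k o) + f' i (v i)) (v i - u i k t o).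
rewrite -/(E o) (nuB (nu_norm i)) -opprB dotNr dotDl.
move: (nu i _) VL => n VL En st.
have sq : E o * n <= (2 * eta)^-1 * E o ^+ 2 + eta * (n ^+ 2 / 2).
  have : 0 <= (E o - eta * n) ^+ 2 / (2 * eta).
    by rewrite divr_ge0 ?sqr_ge0// mulr_ge0// ltW.
  have -> : (E o - eta * n) ^+ 2 / (2 * eta) =
    (2 * eta)^-1 * E o ^+ 2 + eta * (n ^+ 2 / 2) - E o * n by field; rewrite gt_eqF.
  by rewrite subr_ge0.
have VL' := ler_wpM2l (ltW eta_gt0) VL.
rewrite (ger0_norm V0) (le_trans _ (ler_norm _))// ler_pdivlMl//.
rewrite (mulrC b^-1); lra.
Qed.

End ProxStep.

Lemma inner_ok i k : (1 <= k <= N)%N -> iterate_ok i (fun o => row i (x k.-1 o)) ->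
  entry_measurable (w k) -> sq_dominated P (w k) ->
  forall t, (t <= T)%N -> iterate_ok i (u i k t).
Proof.
move=> kN okx mw dw; elim=> [_|t IHt tT].
  have -> // : u i k 0%N = (fun o => row i (x k.-1 o)).
  by apply/funext => o; exact: (sdcs_u0 (run o) i kN).
exact: (prox_ok kN (t := t.+1) tT (IHt (ltnW tT)) okx mw dw).
Qed.

Let L : R := \sum_(1 <= t < T.+1) (t%:R + 1).

Definition noise i k t o : R :=
  - dot (h i k t.-1 o - f' i (u i k t.-1 o)) (u i k t.-1 o - v i) +
  (M ^+ 2 + dual_norm (nu i) (h i k t.-1 o - f' i (u i k t.-1 o)) ^+ 2) / (eta * (t%:R / 2)).

(** The choice [eta = 2 nA] turns the surplus coefficient [eta / 2] of [inner_loop] into the [nA]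
    that the outer coupling consumes. *)
Lemma inner_path i k o : (1 <= k <= N)%N -> X i (row i (x k.-1 o)) ->
  X i (row i (xhat k o)) /\
  dot (row i (w k o)) (row i (xhat k o) - v i) + f i (row i (xhat k o)) - f i (v i) +
    nA * nu i (row i (x k.-1 o) - row i (xhat k o)) ^+ 2 +
    eta * (1 + L^-1) * V i (row i (x k o)) (v i) <=
  eta * (1 + L^-1) * V i (row i (x k.-1 o)) (v i) +
    L^-1 * \sum_(1 <= t < T.+1) (t%:R + 1) * noise i k t o.
Proof.
move=> kN Xx.
have arg t : (1 <= t <= T)%N -> is_argmin (X i)
  (fun z => dot (row i (w k o) + h i k t.-1 o) z + eta * V i (row i (x k.-1 o)) z
            + eta * (t%:R / 2) * V i (u i k t.-1 o) z) (u i k t o).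
  by move=> tT; exact: (sdcs_u (run o) i kN tT).
have u0 : u i k 0%N o = row i (x k.-1 o) by exact: (sdcs_u0 (run o) i kN).
have := inner_loop (nu_norm i) (cX (i:=i)) (pom i) (fobj i) eta_gt0 Xx (@Xv i)
  (u := fun t => u i k t o) (h := fun t => h i k t o) u0 arg T_ge1.
have e1 := sdcs_xhat (run o) i kN; rewrite /= in e1; rewrite -/L in e1 *; rewrite -e1.
have e2 := sdcs_x (run o) i kN; rewrite /= in e2; rewrite -e2.
by have -> : eta / 2 = nA by field.
Qed.

(** These are the quantities that later stages read; [w] and the inner iterates are recovered within
    a stage. *)
Definition stage_ok k :=
  [/\ entry_measurable (xhat k) /\ sq_dominated P (xhat k),
      entry_measurable (y k) /\ sq_dominated P (y k) &
      forall i, iterate_ok i (fun o => row i (x k o))].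

Lemma stage_x k : stage_ok k -> entry_measurable (x k) /\ sq_dominated P (x k).
Proof.
move=> [_ _ okx]; split.
  by apply: entry_measurable_rows => i; have [] := okx i.
by apply: sq_dominated_rows => i; exact: iterate_ok_sq.
Qed.

Lemma stage_w k : (1 <= k <= N)%N -> entry_measurable (y k) /\ sq_dominated P (y k) ->
  entry_measurable (w k) /\ sq_dominated P (w k).
Proof.
move=> kN [my dy]; have -> : w k = (fun o => A *m y k o).
  by apply/funext => o; exact: (sdcs_w (run o) kN).
by split; [exact: entry_measurable_mulmx|exact: sq_dominated_mulmx].
Qed.

(** The induction is strong because the extrapolation at stage [k.+1] reads [x k.-1] besides stage
    [k]. *)
Lemma stages_ok k : (k <= N)%N -> stage_ok k.
Proof.
elim/ltn_ind: k => -[_ _|k IHk kN].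
  have xE : x 0%N = fun=> x0 by apply/funext => o; exact: sdcs_x0 (run o).
  split.
  - have -> : xhat 0%N = fun=> x0 by apply/funext => o; exact: sdcs_xhat0 (run o).
    by split; [exact: entry_measurable_cst|exact: sq_dominated_cst].
  - have -> : y 0%N = fun=> y0 by apply/funext => o; exact: sdcs_y0 (run o).
    by split; [exact: entry_measurable_cst|exact: sq_dominated_cst].
  - move=> i; rewrite xE; split; [exact: entry_measurable_cst| |exact: dominated_cst].
    by move=> o; exact: Xx0.
have kN' : (1 <= k.+1 <= N)%N by [].
have ok1 := IHk k (ltnSn k) (ltnW kN).
have [mx1 dx1] := stage_x ok1.
have [mx2 dx2] : entry_measurable (x k.-1) /\ sq_dominated P (x k.-1).
  by apply: stage_x; apply: IHk; [rewrite ltnS leq_pred|rewrite (leq_trans (leq_pred _))// ltnW].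
have [[mxh dxh] [my dy] okx] := ok1.
have okY : entry_measurable (y k.+1) /\ sq_dominated P (y k.+1).
  have -> : y k.+1 = fun o => y k o + nA^-1 *: (A *m (1 *: (xhat k o - x k.-1 o) + x k o)).
    by apply/funext => o; rewrite [LHS](sdcs_y (run o) kN') (sdcs_xtil (run o) kN').
  split.
    apply: entry_measurableD => //; apply/entry_measurableZ/entry_measurable_mulmx.
    by apply: entry_measurableD => //; apply/entry_measurableZ/entry_measurableB.
  apply: sq_dominatedD => //; apply/sq_dominatedZ/sq_dominated_mulmx.
  by apply: sq_dominatedD => //; apply/sq_dominatedZ/sq_dominatedB.
have [mw dw] := stage_w kN' okY.
have oku i t := @inner_ok i k.+1 kN' (okx i) mw dw t.
split => //; last first.
  move=> i; have -> : (fun o => row i (x k.+1 o)) = u i k.+1 T.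
    by apply/funext => o; exact: (sdcs_x (run o) i kN').
  exact: oku.
have xhatE i : (fun o => row i (xhat k.+1 o)) =
    fun o => L^-1 *: \sum_(1 <= t < T.+1) (t%:R + 1) *: u i k.+1 t o.
  by apply/funext => o; exact: (sdcs_xhat (run o) i kN').
split.
  apply: entry_measurable_rows => i; rewrite xhatE; apply/entry_measurableZ.
  apply: entry_measurable_sum => t; rewrite mem_index_iota ltnS => /andP[_ tT].
  by apply/entry_measurableZ; have [] := oku i t tT.
apply: sq_dominated_rows => i; rewrite xhatE; apply/sq_dominatedZ.
apply: sq_dominated_sum => t; rewrite mem_index_iota ltnS => /andP[_ tT].
by apply/sq_dominatedZ/iterate_ok_sq/oku.
Qed.

Lemma inner_iterate_ok i k t : (1 <= k <= N)%N -> (t <= T)%N -> iterate_ok i (u i k t).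
Proof.
move=> kN; case/andP: (kN) => k1 kN'.
have [_ _ okx] := stages_ok (leq_trans (leq_pred k) kN').
have [_ oky _] := stages_ok kN'; have [mw dw] := stage_w kN oky.
exact: inner_ok.
Qed.

Lemma stage_mem i k o : (k <= N)%N -> X i (row i (x k o)).
Proof. by move=> kN; have [_ _ /(_ i)[]] := stages_ok kN. Qed.

Let W k o := eta * (1 + L^-1) * sum_bregman om gom (x k o) xstar.
Let e k o := L^-1 * \sum_i \sum_(1 <= t < T.+1) (t%:R + 1) * noise i k t o.
Let F k o := total_obj f (xhat k o) - total_obj f xstar.

(** Summing [inner_path] over the agents yields the [primal_step] that the outer loop takes as
    input. *)
Lemma stage_primal k o : (1 <= k <= N)%N ->
  F k o + dot (A *m y k o) (xhat k o - xstar)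
    + nA * primal_norm nu (x k.-1 o - xhat k o) ^+ 2 + W k o <= W k.-1 o + e k o.
Proof.
move=> kN; have kN1 : (k.-1 <= N)%N by case/andP: kN => _; exact/leq_trans/leq_pred.
have hi i := (inner_path kN (stage_mem i o kN1)).2.
have := ler_sum (index_enum 'I_m) (P := xpredT) (fun i _ => hi i).
have -> : A *m y k o = w k o by exact/esym/(sdcs_w (run o) kN).
rewrite !big_split/= sumrN -!mulr_sumr.
rewrite dot_row primal_norm_sq /F /total_obj /W /sum_bregman /e.
have e1 : \sum_i dot (row i (w k o)) (row i (xhat k o - xstar)) =
    \sum_i dot (row i (w k o)) (row i (xhat k o) - v i).
  by apply: eq_bigr => i _; rewrite linearB.
have e2 : \sum_i nu i (row i (x k.-1 o - xhat k o)) ^+ 2 =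
    \sum_i nu i (row i (x k.-1 o) - row i (xhat k o)) ^+ 2.
  by apply: eq_bigr => i _; rewrite linearB.
rewrite e1 e2; lra.
Qed.

(** * Expected noise and the final bounds *)

Variable D : R.
Hypotheses (N_ge1 : (1 <= N)%N) (D_gt0 : 0 < D).
Hypothesis T_large : m%:R * (M ^+ 2 + sigma ^+ 2) * N%:R / (nA ^+ 2 * D) <= T%:R.
Hypothesis saddle : forall z, prod_set X z ->
  lagrangian A f xstar ystar <= lagrangian A f z ystar.

Lemma noise_mean i k t : (1 <= k <= N)%N -> (1 <= t <= T)%N ->
  mean_at_most P (noise i k t) ((M ^+ 2 + sigma ^+ 2) / (eta * (t%:R / 2))).
Proof.
move=> kN tT; have oku : iterate_ok i (u i k t.-1).
  by apply: inner_iterate_ok => //; case/andP: tT => _; exact/leq_trans/leq_pred.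
have b0 : 0 <= (eta * (t%:R / 2))^-1 by rewrite invr_ge0 mulr_ge0 ?divr_ge0// ltW.
have := mean_at_mostD (noise_unbiased kN tT oku)
  (mean_at_mostZ b0 (mean_at_mostD (mean_at_most_cst P (M ^+ 2)) (noise_variance kN tT oku))).
rewrite add0r; congr (mean_at_most P _ _); last by rewrite mulrC.
by apply/funext => o; rewrite /noise /cst [in RHS](mulrC _ _^-1).
Qed.

(** From [L = T (T + 3) / 2]. The first bound makes the averaged noise of order [1 / T]; the second
    gives [eta (1 + 1 / L) <= 3 nA], the source of the factor 3. *)
Lemma L_ge : T%:R ^+ 2 / 2 <= L /\ 2 <= L.
Proof.
have T1 : 1 <= T%:R :> R by rewrite ler1n.
rewrite /L sum_weights; split; nra.
Qed.

(** With [B = M^2 + sigma^2], each inner step contributes [(t + 1) B / (eta t / 2) <= 4 B / eta],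
    since [(t + 1) / t <= 2]. Over [m] agents and [T] steps, [L >= T^2 / 2] leaves [4 m B / (nA T)],
    which [T_large] turns into [4 nA D / N]. *)
Lemma e_mean k : (1 <= k <= N)%N -> mean_at_most P (e k) (4 * nA * D / N%:R).
Proof.
move=> kN; have [L1 L2] := L_ge.
have L0 : 0 < L by apply: lt_le_trans L2.
have T0 : 0 < T%:R :> R by rewrite ltr0n.
have N0 : 0 < N%:R :> R by rewrite ltr0n.
have TL := T_large; set B := M ^+ 2 + sigma ^+ 2 in TL *.
have B0 : 0 <= B by rewrite addr_ge0 ?sqr_ge0.
have Li0 : 0 <= L^-1 by rewrite invr_ge0 ltW.
have hs i : mean_at_most P (fun o => \sum_(1 <= t < T.+1) (t%:R + 1) * noise i k t o)
    (T%:R * (4 * B / eta)).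
  have -> : T%:R * (4 * B / eta) = \sum_(1 <= t < T.+1) 4 * B / eta.
    by rewrite sumr_const_nat subSS subn0 mulr_natl.
  rewrite [X in mean_at_most _ _ X]big_seq.
  apply: (@mean_at_mostW _ _ _ _ _ (\sum_(1 <= t < T.+1) (t%:R + 1) * (B / (eta * (t%:R / 2))))).
    rewrite big_seq; apply: ler_sum => t; rewrite mem_index_iota => /andP[t1 _].
    have t1' : 1 <= t%:R :> R by rewrite ler1n.
    have t0 : 0 < t%:R :> R by rewrite ltr0n.
    have -> : (t%:R + 1) * (B / (eta * (t%:R / 2))) = (2 * (t%:R + 1) / t%:R) * (B / eta).
      by field; rewrite !gt_eqF.
    rewrite -[leRHS]mulrA ler_wpM2r ?divr_ge0 ?(ltW eta_gt0)//.
    by rewrite ler_pdivrMr//; lra.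
  apply: mean_at_most_sum => t; rewrite mem_index_iota ltnS => tT.
  by apply: mean_at_mostZ; [rewrite addr_ge0|exact: noise_mean].
have := mean_at_mostZ Li0 (mean_at_most_sum (r := index_enum 'I_m) (fun i _ => hs i)).
apply: mean_at_mostW; rewrite sumr_const card_ord -[_ *+ m]mulr_natl.
have T2 : m%:R * B * N%:R <= T%:R * (nA ^+ 2 * D).
  by rewrite -ler_pdivrMr// mulr_gt0// exprn_gt0.
rewrite ler_pdivlMr//.
have -> : L^-1 * (m%:R * (T%:R * (4 * B / eta))) * N%:R =
  2 / nA * (L^-1 * T%:R * (m%:R * B * N%:R)) by field; rewrite !gt_eqF.
apply: (@le_trans _ _ (2 / nA * (2 * (nA ^+ 2 * D)))); last first.
  by rewrite le_eqVlt; apply/orP; left; apply/eqP; field; rewrite gt_eqF.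
rewrite ler_wpM2l ?divr_ge0 ?(ltW nA_gt0)//.
rewrite -mulrA mulrC ler_pdivrMr//.
apply: (@le_trans _ _ (T%:R * (T%:R * (nA ^+ 2 * D)))); first by rewrite ler_wpM2l// ltW.
have : 0 <= nA ^+ 2 * D by rewrite mulr_ge0 ?sqr_ge0// ltW.
move: (nA ^+ 2 * D) => q q0; nra.
Qed.

Lemma total_e_mean : mean_at_most P (fun o => \sum_(1 <= k < N.+1) e k o) (4 * nA * D).
Proof.
have -> : 4 * nA * D = \sum_(1 <= k < N.+1) 4 * nA * D / N%:R.
  rewrite sumr_const_nat subSS subn0 -[RHS]mulr_natl; field.
  by rewrite pnatr_eq0 -lt0n.
apply: mean_at_most_sum => k; rewrite mem_index_iota ltnS => kN; exact: e_mean.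
Qed.

Let Vstar := sum_bregman om gom x0 xstar.

Lemma Vstar_ge0 : 0 <= Vstar.
Proof.
by apply: sumr_ge0 => i _; apply: (bregman_ge0 (nu_norm i) (cX (i:=i)) (pom i)).
Qed.

Let W_ge0 o k : (k <= N)%N -> 0 <= W k o.
Proof.
move=> kN; have [_ L2] := L_ge.
rewrite /W mulr_ge0//.
  by rewrite mulr_ge0 ?(ltW eta_gt0)// addr_ge0// invr_ge0 (le_trans _ L2).
apply: sumr_ge0 => i _; apply: (bregman_ge0 (nu_norm i) (cX (i:=i)) (pom i)) => //.
exact: stage_mem.
Qed.

Let W0_le o : W 0%N o <= 3 * nA * Vstar.
Proof.
have [_ L2] := L_ge; rewrite /W (sdcs_x0 (run o)) -/Vstar ler_wpM2r ?Vstar_ge0//.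
have : L^-1 <= 2^-1 by rewrite lef_pV2 ?posrE// (lt_le_trans _ L2).
by move=> /(ler_wpM2l (ltW nA_gt0)); lra.
Qed.

Let xtilE o k : (1 <= k <= N)%N -> xtil k o = xhat k.-1 o - x k.-2 o + x k.-1 o.
Proof. by move=> kN; rewrite [LHS](sdcs_xtil (run o) kN) scale1r. Qed.

Let xhat0E o : xhat 0%N o = x 0%N o.
Proof. by rewrite [LHS](sdcs_xhat0 (run o)) [RHS](sdcs_x0 (run o)). Qed.

Lemma path_objective o : \sum_(1 <= k < N.+1) F k o <=
  3 * nA * Vstar + nA / 2 * l2norm y0 ^+ 2 + \sum_(1 <= k < N.+1) e k o.
Proof.
have := outer_objective nu_norm A_sym nA_gt0 (x := x^~ o) (xhat := xhat^~ o)
  (xtil := xtil^~ o) (y := y^~ o) (F := F^~ o) (W := W^~ o) (e := e^~ o) (xhat0E o) Axstar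
  (xtilE o) (fun k kN => sdcs_y (run o) kN) (W_ge0 o) (fun k kN => stage_primal o kN).
rewrite subr0 (sdcs_y0 (run o)); have := W0_le o; lra.
Qed.

Lemma xhat_mem k o : (1 <= k <= N)%N -> prod_set X (xhat k o).
Proof.
move=> kN i; apply: (inner_path kN _).1; apply: stage_mem.
by case/andP: kN => _; exact/leq_trans/leq_pred.
Qed.

(** As [A xstar = 0], the Lagrangian at the saddle point is the optimal value. The bound serves
    twice: for the sign needed in [outer_feasibility], and for integrability of the objective gap
    from below. *)
Lemma saddle_gap z : prod_set X z ->
  0 <= total_obj f z - total_obj f xstar + dot (A *m z) ystar.
Proof. by move=> Xz; have := saddle Xz; rewrite /lagrangian Axstar dot0l; lra. Qed.

Lemma path_feasibility (c : R) o : 0 < c ->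
  l2norm (A *m (\sum_(1 <= k < N.+1) xhat k o)) <=
  5 / c * (3 * nA * Vstar + nA / 2 * l2norm (ystar - y0) ^+ 2 + \sum_(1 <= k < N.+1) e k o)
  + nA * (c / 2 + l2norm (ystar - y0)).
Proof.
move=> c0.
have sp : 0 <= \sum_(1 <= k < N.+1) (F k o + dot (A *m xhat k o) ystar).
  rewrite big_seq; apply: sumr_ge0 => k; rewrite mem_index_iota ltnS => kN.
  exact/saddle_gap/xhat_mem.
have := outer_feasibility nu_norm A_sym nA_gt0 (x := x^~ o) (xhat := xhat^~ o)
  (xtil := xtil^~ o) (y := y^~ o) (F := F^~ o) (W := W^~ o) (e := e^~ o) (xhat0E o) Axstar
  (xtilE o) (fun k kN => sdcs_y (run o) kN) (W_ge0 o) (fun k kN => stage_primal o kN) c0 sp.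
have -> : y 0%N o = y0 by exact: sdcs_y0 (run o).
have -> : l2norm (y0 - ystar) = l2norm (ystar - y0) by rewrite -l2normN opprB.
move=> /le_trans; apply; rewrite lerD2r ler_wpM2l ?divr_ge0 ?(ltW c0)//.
by rewrite !lerD2r W0_le.
Qed.

Let xavg o := N%:R^-1 *: \sum_(1 <= k < N.+1) xhat k o : 'M[R]_(m, d).

Lemma xavg_jensen i o : X i (row i (xavg o)) /\
  N%:R * f i (row i (xavg o)) <= \sum_(1 <= k < N.+1) f i (row i (xhat k o)).
Proof.
have cf : convex_on (X i) (f i).
  by move=> *; exact: (convex_function_comb (objective_convex (fobj i))).
have [|_] := jensen (a := fun=> 1) (z := fun k => row i (xhat k o)) (cX (i:=i)) cf N_ge1.
  by move=> k kN; split => //; exact: xhat_mem.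
have -> : \sum_(1 <= t < N.+1) 1 = N%:R :> R by rewrite sumr_const_nat subSS subn0.
have -> : \sum_(1 <= t < N.+1) 1 *: row i (xhat t o) = row i (\sum_(1 <= k < N.+1) xhat k o).
  by rewrite linear_sum; apply: eq_bigr => k _; rewrite scale1r.
rewrite -linearZ/= => Xa J; split => //; apply: (le_trans J).
by under eq_bigr do rewrite mul1r.
Qed.

Lemma xavg_objective o :
  total_obj f (xavg o) - total_obj f xstar <= N%:R^-1 * \sum_(1 <= k < N.+1) F k o.
Proof.
have N0 : 0 < N%:R :> R by rewrite ltr0n.
rewrite -(ler_pM2l N0) mulrA divff ?gt_eqF// mul1r sumrB sumr_const_nat subSS subn0.
rewrite -[in leRHS]mulr_natl mulrBr lerD2r /total_obj exchange_big/= mulr_sumr.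
by apply: ler_sum => i _; have [] := xavg_jensen i o.
Qed.

Lemma xavg_measurable : entry_measurable xavg.
Proof.
apply: entry_measurableZ; apply: entry_measurable_sum => k.
rewrite mem_index_iota ltnS => /andP[_ kN].
by have [[]] := stages_ok kN.
Qed.

Lemma measurable_feasibility : measurable_fun setT (fun o => l2norm (A *m xavg o)).
Proof.
have mA := entry_measurable_mulmx A xavg_measurable.
apply: (measurableT_comp _ (measurable_dot mA mA)).
by apply: continuous_measurable_fun; exact: sqrt_continuous.
Qed.

Lemma measurable_objective :
  measurable_fun setT (fun o => total_obj f (xavg o) - total_obj f xstar).
Proof.
apply: measurable_funB; last exact: measurable_cst.
apply: measurable_sum => i.
apply: (measurable_modulus (entry_measurable_row i xavg_measurable)) => o eps eps0.
have [C C0 hC] := objective_lip (nu_norm i) (fobj i) (xavg_jensen i o).1.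
exists (eps / C) => [|o' oo']; first exact: divr_gt0.
rewrite distrC (le_lt_trans (hC _ (xavg_jensen i o').1))//.
by rewrite distrC mulrC -ltr_pdivlMr.
Qed.

Lemma feasibility_bound : mean_at_most P (fun o => l2norm (A *m xavg o))
  (nA / N%:R * (3 * Num.sqrt (6 * Vstar + 8 * D) + 4 * l2norm (ystar - y0))).
Proof.
set De := l2norm (ystar - y0); set s := Num.sqrt _.
have De0 : 0 <= De by exact: l2norm_ge0.
have N0 : 0 < N%:R :> R by rewrite ltr0n.
have V0 := Vstar_ge0.
have S0 : 0 < 6 * Vstar + 8 * D by rewrite ltr_wpDl ?mulr_ge0 ?mulr_gt0.
have s0 : 0 < s by rewrite sqrtr_gt0.
have s2 : s ^+ 2 = 6 * Vstar + 8 * D by rewrite sqr_sqrtr ?ltW.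
(* The quantity multiplied by [5 / c] in [path_feasibility] has mean at most [nA (s^2 + De^2) / 2].
   Since [c^2 >= 5 (s^2 + De^2)], both terms of the linearized root are at most [nA c / 2], and
   [c + De = 3 s + 4 De] is the stated constant. *)
pose c := 3 * s + 3 * De.
have c0 : 0 < c by rewrite /c; lra.
pose Z o := N%:R^-1 * (5 / c * (\sum_(1 <= k < N.+1) e k o +
  (3 * nA * Vstar + nA / 2 * De ^+ 2)) + nA * (c / 2 + De)).
have Yz o : l2norm (A *m xavg o) <= Z o.
  rewrite /xavg -scalemxAr l2normZ ger0_norm ?invr_ge0 ?(ltW N0)//.
  rewrite ler_wpM2l ?invr_ge0 ?(ltW N0)// (le_trans (path_feasibility o c0))//.
  by rewrite addrC [leRHS]addrC lerD2l (addrC (\sum_(_ <= _ < _) _)).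
have c5 : 0 <= 5 / c by rewrite divr_ge0// ltW.
have Ni : 0 <= N%:R^-1 :> R by rewrite invr_ge0 ltW.
have mZ := mean_at_mostZ Ni (mean_at_mostD (mean_at_mostZ c5 (mean_at_mostD total_e_mean
  (mean_at_most_cst P (3 * nA * Vstar + nA / 2 * De ^+ 2))))
  (mean_at_most_cst P (nA * (c / 2 + De)))).
have dY : dominated P (fun o => l2norm (A *m xavg o)).
  apply: dominated_le (dominated_mean mZ) => o.
  by rewrite ger0_norm ?l2norm_ge0// (le_trans (Yz o))// ler_norm.
have := mean_at_most_le measurable_feasibility dY Yz mZ.
apply: mean_at_mostW.
have -> : 5 / c * (4 * nA * D + (3 * nA * Vstar + nA / 2 * De ^+ 2)) =
    nA * (5 / (2 * c) * (s ^+ 2 + De ^+ 2)) by rewrite s2; field; rewrite gt_eqF.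
rewrite -mulrDr mulrA (mulrC _ nA) ler_wpM2l ?divr_ge0 ?(ltW nA_gt0) ?(ltW N0)//.
have sD : 5 / (2 * c) * (s ^+ 2 + De ^+ 2) <= c / 2.
  rewrite -subr_ge0.
  have -> : c / 2 - 5 / (2 * c) * (s ^+ 2 + De ^+ 2) =
      (c ^+ 2 - 5 * (s ^+ 2 + De ^+ 2)) / (2 * c) by field; rewrite gt_eqF.
  rewrite divr_ge0 ?mulr_ge0 ?(ltW c0)// /c; nra.
by rewrite /c in sD *; lra.
Qed.

Lemma objective_bound :
  mean_at_most P (fun o => total_obj f (xavg o) - total_obj f xstar)
    (nA / N%:R * (3 * Vstar + 1 / 2 * l2norm y0 ^+ 2 + 4 * D)).
Proof.
have N0 : 0 < N%:R :> R by rewrite ltr0n.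
have Ni : 0 <= N%:R^-1 :> R by rewrite invr_ge0 ltW.
pose Z o := N%:R^-1 * (\sum_(1 <= k < N.+1) e k o + (3 * nA * Vstar + nA / 2 * l2norm y0 ^+ 2)).
have mZ := mean_at_mostZ Ni (mean_at_mostD total_e_mean
  (mean_at_most_cst P (3 * nA * Vstar + nA / 2 * l2norm y0 ^+ 2))).
have YZ o : total_obj f (xavg o) - total_obj f xstar <= Z o.
  rewrite (le_trans (xavg_objective o))// ler_wpM2l// addrC; exact: path_objective.
(* From above the gap is at most [Z]; from below, by the saddle inequality, it is at least minus
   [l2norm ystar] times the infeasibility, which is integrable by [feasibility_bound]. *)
have dY : dominated P (fun o => total_obj f (xavg o) - total_obj f xstar).
  have [iL _] := feasibility_bound.
  have dL : dominated P (fun o => l2norm (A *m xavg o)) := dominated_mean feasibility_bound.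
  have [B iB hB] := dominated_mean mZ; have [B' iB' hB'] := dominatedZ (l2norm ystar) dL.
  exists (fun o => B o + B' o); first exact: (integrableD measurableT iB iB').
  move=> o; have ZB := hB o; have LB := hB' o.
  have := YZ o; have := saddle_gap (fun i => (xavg_jensen i o).1).
  have := dot_le_l2norm (A *m xavg o) ystar.
  move: ZB LB; rewrite -/(Z o) !ler_norml => /andP[? ?] /andP[? ?] *.
  by apply/andP; split; lra.
have := mean_at_most_le measurable_objective dY YZ mZ; apply: mean_at_mostW.
by rewrite le_eqVlt; apply/orP; left; apply/eqP; field; rewrite gt_eqF.
Qed.

End Sdcs.

Theorem theorem5 (R : realType) (m d : nat) (e : rel 'I_m)
  (X : 'I_m -> set 'rV[R]_d) (nu : 'I_m -> 'rV[R]_d -> R)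
  (f : 'I_m -> 'rV[R]_d -> R) (f' : 'I_m -> 'rV[R]_d -> 'rV[R]_d) (M : R)
  (om : 'I_m -> 'rV[R]_d -> R) (gom : 'I_m -> 'rV[R]_d -> 'rV[R]_d)
  (xstar ystar : 'M[R]_(m, d))
  (dO : measure_display) (Omega : measurableType dO) (P : probability Omega R)
  (dXi : 'I_m -> measure_display) (Xi : forall i, measurableType (dXi i))
  (G : forall i, 'rV[R]_d -> Xi i -> 'rV[R]_d) (sigma : R)
  (xi : forall i, nat -> nat -> {RV P >-> Xi i})
  (N : nat) (D : R) (x0 y0 : 'M[R]_(m, d))
  (x xhat xtil y w : nat -> Omega -> 'M[R]_(m, d))
  (h u : 'I_m -> nat -> nat -> Omega -> 'rV[R]_d)
  (L := laplacian R e) (nL := opnorm nu L)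
  (T := fun _ : nat => `|Num.ceil (m%:R * (M ^+ 2 + sigma ^+ 2) * N%:R
                                   / (nL ^+ 2 * D))|%N)
  (xavg := fun o => N%:R^-1 *: \sum_(1 <= k < N.+1) xhat k o : 'M[R]_(m, d)) :
  (2 <= m)%N -> (1 <= d)%N -> connected_undirected e ->
  (forall i, closed (X i)) -> (forall i, convex_set (X i)) ->
  (exists z, forall i, X i z) ->
  (forall i, is_norm (nu i)) ->
  0 < M ->
  (forall i, objective (X i) (nu i) 0 M (f i) (f' i)) ->
  (forall i, prox_function (X i) (nu i) (om i) (gom i)) ->
  optimal_solution L X f xstar ->
  saddle_point L X f xstar ystar ->
  (forall i, measurable_fun ((X i `*` setT) : set (borel_rV R d * Xi i))
     (fun z => G i z.1 z.2 : borel_rV R d)) ->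
  (forall i k t z, (1 <= k <= N)%N -> (t < T k)%N -> X i z ->
     has_mean P (fun o => G i z (xi i k t o)) (f' i z)) ->
  (forall i k t z, (1 <= k <= N)%N -> (t < T k)%N -> X i z ->
     mean_at_most P (fun o => dual_norm (nu i) (G i z (xi i k t o) - f' i z) ^+ 2)
       (sigma ^+ 2)) ->
  (forall i k t, (1 <= k <= N)%N -> (t < T k)%N ->
     independent_rv P (xi i k t) (u i k t : Omega -> borel_rV R d)) ->
  (1 <= N)%N -> 0 < D ->
  prod_set X x0 ->
  (forall o, sdcs_run L X om gom G N
     (fun=> 1) (fun=> nL) (fun=> 2 * nL) T (fun t => t%:R + 1) (fun t => t%:R / 2)
     x0 y0 (fun i k t => xi i k t o)
     (x^~ o) (xhat^~ o) (xtil^~ o) (y^~ o) (w^~ o)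
     (fun i k t => h i k t o) (fun i k t => u i k t o)) ->
  mean_at_most P (fun o => total_obj f (xavg o) - total_obj f xstar)
    (nL / N%:R * (3 * sum_bregman om gom x0 xstar + 1 / 2 * l2norm y0 ^+ 2 + 4 * D))
  /\
  mean_at_most P (fun o => l2norm (L *m xavg o))
    (nL / N%:R * (3 * Num.sqrt (6 * sum_bregman om gom x0 xstar + 8 * D)
                  + 4 * l2norm (ystar - y0))).
Proof.
move=> m2 d1 e_conn clX cX _ nu_norm M0 fobj pom [Xs Ls _] [_ _ saddle] mG unb var ind.
move=> N1 D0 Xx0 run.
have nL0 : 0 < nL by exact: laplacian_opnorm_gt0.
pose t := m%:R * (M ^+ 2 + sigma ^+ 2) * N%:R / (nL ^+ 2 * D).
(* [M > 0] makes [t] positive, so its ceiling is a positive integer, the absolute value leaves it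
   unchanged, and the inner loop has at least one step. *)
have t0 : 0 < t.
  rewrite /t divr_gt0 ?mulr_gt0 ?exprn_gt0 ?ltr0n//; first exact: ltnW.
  by rewrite ltr_wpDr ?sqr_ge0 ?exprn_gt0.
have ct : (0 < Num.ceil t)%R by rewrite ceil_gt0.
have T1 : (1 <= `|Num.ceil t|)%N by rewrite absz_gt0 gt_eqF.
have Tt : t <= `|Num.ceil t|%N%:R.
  by rewrite natr_absz gtr0_norm// ceil_ge.
split.
  exact: (objective_bound (laplacian_sym R e_conn) nL0 Ls clX cX nu_norm fobj pom Xs mG
    unb var ind T1 Xx0 run N1 D0 Tt saddle).
exact: (feasibility_bound (laplacian_sym R e_conn) nL0 Ls clX cX nu_norm fobj pom Xs mG
    unb var ind T1 Xx0 run N1 D0 Tt saddle).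
Qed.
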